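(* Let $\mathcal{X}$ be a Polish space and $P\in\mathcal{P}(\mathcal{X})$. Let $\mathcal{L}:\mathcal{X}\to[-\infty,\infty)$ be a measurable function such that either (a) $\mathcal{L}$ is bounded below, or (b) $\mathcal{L}$ is bounded above and $\mathcal{L}^-\in L^1(P)$ (where $\mathcal{L}^-$ is the negative part of $\mathcal{L}$). Let $D$ be a pre-divergence such that $Q\mapsto D(Q\|P)$ is convex, and let $c$ be a cost function with $c(x,x)=0$ for all $x\in\mathcal{X}$. Then for all $\epsilon>0$ and $\kappa\geq 0$, \[ \sup_{Q\in\mathcal{P}(\mathcal{X}):D^c(Q\|P)\leq \epsilon}\{E_Q[\mathcal{L}]-\kappa D^c(Q\|P)\} =\inf_{\lambda>0}\Big\{\lambda \epsilon+(\lambda+\kappa)\sup_{Q\in\mathcal{P}(\mathcal{X}):D(Q\|P)<\infty}\{E_{Q}[ \mathcal{L}_{\lambda+\kappa}^c]- D(Q\|P)\}\Big\}. \]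
   Context: $\mathcal{X}$ is a Polish space with its Borel $\sigma$-algebra; $\mathcal{P}(\mathcal{X})$ is the set of Borel probability measures on $\mathcal{X}$ with the topology of weak convergence. A pre-divergence is a map $D:\mathcal{P}(\mathcal{X})\times\mathcal{P}(\mathcal{X})\to[0,\infty]$ with $D(\mu\|\mu)=0$ for all $\mu$. A cost function is a lower semicontinuous $c:\mathcal{X}\times\mathcal{X}\to[0,\infty]$; its optimal transport cost is $C(\mu,\nu)=\inf\{\int c\,d\pi:\pi\in\mathcal{P}(\mathcal{X}\times\mathcal{X}),\pi_1=\mu,\pi_2=\nu\}$ ($\pi_i$ the marginals). The OT-regularized divergence is $D^c(\nu\|\mu)=\inf_{\eta\in\mathcal{P}(\mathcal{X})}\{D(\eta\|\mu)+C(\eta,\nu)\}$. For $\lambda>0$ the OT-regularized loss is $\mathcal{L}^c_\lambda(x)=\sup_{y\in\mathcal{X}}\{\mathcal{L}(y)/\lambda-c(x,y)\}$; it is universally measurable and expectations of it are taken with respect to the completion of the measure. *)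

(* Defs.v *)
From HB Require Import structures.
From mathcomp Require Import all_boot all_order all_algebra.
From mathcomp Require Import all_classical all_reals all_analysis.
From mathcomp Require Import measurable_realfun.

Set Implicit Arguments.
Unset Strict Implicit.
Unset Printing Implicit Defensive.

Import Order.TTheory GRing.Theory Num.Theory.
Local Open Scope classical_set_scope.
Local Open Scope ring_scope.

Definition is_metric {R : realType} {T : Type} (d : T -> T -> R) : Prop :=
  (forall x y, 0 <= d x y) /\ (forall x y, d x y = 0 <-> x = y) /\
  (forall x y, d x y = d y x) /\ (forall x y z, d x z <= d x y + d y z).

Definition metric_induces_topology {R : realType} {T : topologicalType}
    (d : T -> T -> R) : Prop :=
  forall U : set T, open U <->
    (forall x, U x -> exists2 e : R, 0 < e & [set y | d x y < e] `<=` U).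

Definition metric_complete {R : realType} {T : Type} (d : T -> T -> R) : Prop :=
  forall u : nat -> T,
    (forall e : R, 0 < e -> exists N, forall m n, (N <= m)%N -> (N <= n)%N ->
        d (u m) (u n) < e) ->
    exists l : T, forall e : R, 0 < e -> exists N, forall n, (N <= n)%N ->
        d (u n) l < e.

Definition polish (R : realType) (T : topologicalType) : Prop :=
  (exists S : set T, countable S /\ closure S = setT) /\
  (exists d : T -> T -> R,
      is_metric d /\ metric_induces_topology d /\ metric_complete d).

Section pprod.
Variables X Y : ptopologicalType.
Definition pprod := (X * Y)%type.
HB.instance Definition _ := Topological.copy pprod (X * Y)%type.
HB.instance Definition _ := Pointed.copy pprod (X * Y)%type.
End pprod.

Notation borel T := (g_sigma_algebraType (@open T)).
Notation borel_of T := (g_sigma_algebraType (@open T)).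

Definition prob (X : ptopologicalType) (R : realType) :=
  probability (borel X) R.

Local Open Scope ereal_scope.

Definition prob_eq (X : ptopologicalType) (R : realType) (mu nu : prob X R) :=
  forall A : set (borel X), measurable A -> mu A = nu A.

(* pre-divergence: a map on P(X) x P(X) with values in [0, +oo], D(mu||mu)=0.
   D nu mu stands for D(nu || mu).  Since an element of P(X) is represented by
   a measure object, we also require that D only depends on the measures
   as elements of P(X) (i.e. on their values on Borel sets). *)
Definition pre_divergence (X : ptopologicalType) (R : realType)
    (D : prob X R -> prob X R -> \bar R) : Prop :=
  (forall mu nu, 0 <= D nu mu) /\
  (forall mu, D mu mu = 0) /\
  (forall mu mu' nu nu', prob_eq mu mu' -> prob_eq nu nu' ->
      D nu mu = D nu' mu').

Definition convex_in_first (X : ptopologicalType) (R : realType)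
    (D : prob X R -> prob X R -> \bar R) (P : prob X R) : Prop :=
  forall (Q1 Q2 Q : prob X R) (t : R), (0 <= t <= 1)%R ->
    (forall A : set (borel X), measurable A ->
        Q A = t%:E * Q1 A + (1 - t)%:E * Q2 A) ->
    D Q P <= t%:E * D Q1 P + (1 - t)%:E * D Q2 P.

Definition lsc (T : topologicalType) (R : realType) (f : T -> \bar R) : Prop :=
  forall a : \bar R, open [set x | a < f x].

Definition cost_function (X : ptopologicalType) (R : realType)
    (c : pprod X X -> \bar R) : Prop :=
  lsc c /\ (forall p, 0 <= c p).

Definition coupling (X : ptopologicalType) (R : realType)
    (mu nu : prob X R) (pi : prob (pprod X X) R) : Prop :=
  forall A : set (borel X), measurable A ->
    pi (A `*` setT) = mu A /\ pi (setT `*` A) = nu A.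

Definition OTcost (X : ptopologicalType) (R : realType)
    (c : pprod X X -> \bar R) (mu nu : prob X R) : \bar R :=
  ereal_inf [set \int[pi]_p c p | pi in [set pi : prob (pprod X X) R |
                                          coupling mu nu pi]].

Definition OTreg_div (X : ptopologicalType) (R : realType)
    (D : prob X R -> prob X R -> \bar R) (c : pprod X X -> \bar R)
    (nu mu : prob X R) : \bar R :=
  ereal_inf [set D eta mu + OTcost c eta nu | eta in [set: prob X R]].

Definition OTreg_loss (X : ptopologicalType) (R : realType)
    (L : X -> \bar R) (c : pprod X X -> \bar R) (lambda : R) (x : X) : \bar R :=
  ereal_sup [set (lambda^-1)%:E * L y - c (x, y) | y in [set: X]].

Definition Ecompl (X : ptopologicalType) (R : realType) (Q : prob X R)
    (f : X -> \bar R) : \bar R :=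
  \int[@completed_measure_extension _ _ _ Q]_x f x.

(* Main.v *)
(** Write [L_l] for the OT-regularized loss at [l = lambda + kappa], [V eta] for
    [D eta P], and call a coupling [pi] of [eta] and [nu] a plan; it has cost
    [V eta + \int c dpi] and value [\int L dnu].  The primal problem maximizes
    value minus [kappa] times cost over plans of cost at most [eps]: this is a
    concave problem in the plan, with the diagonal coupling of [P] as Slater point
    (its cost is 0), so it has a Lagrange multiplier.  It remains to identify
    [l * sup_eta (\int L_l deta - V eta)] with the supremum over all plans of
    value minus [l] times cost.

    One inequality integrates [L y / l - c (x, y) <= L_l x].  The other needs, for
    given [eta], measurable maps [s] with [L (s x) / l - c (x, s x)] close to
    [L_l x].  They exist up to an [eta]-null set: a Borel set [B] of [X * X] is a
    projection of a closed subset of [X * X * (nat -> nat)] and [X] is a continuous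
    image of a closed set of codes, so the projection [A] of [B] on [X] is a
    projection of a closed [G] in [X * (nat -> nat)]; by Choquet's capacity argument
    bounding the codes coordinatewise loses little of the outer measure of [A],
    and over the resulting compact sections the lexicographically least code
    depends measurably on the point. *)

Require Import Defs.
From HB Require Import structures.
From mathcomp Require Import all_boot all_order all_algebra.
From mathcomp Require Import all_classical all_reals all_analysis.
From mathcomp Require Import measurable_realfun lra.

Import Order.TTheory GRing.Theory Num.Theory.
Local Open Scope classical_set_scope.
Local Open Scope ring_scope.
Local Open Scope ereal_scope.

(** * Analytic sets *)

Definition cvg_metric {R : realType} {Z : Type} (d : Z -> Z -> R)
    (u : nat -> Z) (z : Z) : Prop :=
  forall e : R, (0 < e)%R -> exists N, forall n, (N <= n)%N -> (d (u n) z < e)%R.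

(* Convergence in the Baire space [nat -> nat]. *)
Definition cvg_code (g_ : nat -> nat -> nat) (g : nat -> nat) : Prop :=
  forall i, exists N, forall n, (N <= n)%N -> g_ n i = g i.

(** For a metric [d], sequences suffice to describe closed subsets of [Z * (nat -> nat)], both
    factors being metrizable. *)
Definition seq_closed {R : realType} {Z : Type} (d : Z -> Z -> R)
    (G : Z -> (nat -> nat) -> Prop) : Prop :=
  forall z_ z g_ g, cvg_metric d z_ z -> cvg_code g_ g ->
    (forall n, G (z_ n) (g_ n)) -> G z g.

Definition analytic {R : realType} {Z : Type} (d : Z -> Z -> R) (B : set Z) :=
  exists2 G, seq_closed d G & forall z, B z <-> exists g, G z g.

Lemma natSinv_lt {R : realType} (e : R) :
  (0 < e)%R -> exists n : nat, (n.+1%:R^-1 < e)%R.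
Proof.
move=> e0; exists (Num.bound e^-1).
rewrite invf_plt ?posrE//; apply: (lt_le_trans (archi_boundP _)).
  by rewrite invr_ge0 ltW.
by rewrite ler_nat.
Qed.

Section analytic_sets.
Context {R : realType} {Z : ptopologicalType} (d : Z -> Z -> R).
Hypotheses (dm : is_metric d) (dtop : metric_induces_topology d).

(** For [U], the first entry of the code encodes a radius whose ball about the point stays in [U],
    which is a closed condition. The complement is closed already, so there every code is
    accepted. *)
Lemma analytic_open U : open U -> analytic d U /\ analytic d (~` U).
Proof.
move: dm => [d0 [dE [dC dT]]] /dtop Uo; split.
  exists (fun z g => forall w, (d z w < (g 0%N).+1%:R^-1)%R -> U w).
    move=> z_ z g_ g zz gg H w zw.
    have [N1 hN1] := gg 0%N.
    have [N2 hN2] := zz ((g 0%N).+1%:R^-1 - d z w)%R ltac:(by rewrite subr_gt0).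
    apply: (H (maxn N1 N2)); rewrite hN1 ?leq_maxl//.
    apply: (le_lt_trans (dT _ z _)).
    by rewrite -ltrBrDr; apply: hN2; rewrite leq_maxr.
  move=> z; split=> [/Uo[e e0 H]|[g]]; last first.
    by apply; rewrite (iffRL (dE z z)).
  have [n ne] := natSinv_lt _ e0.
  by exists (fun=> n) => w zw; apply: H => /=; exact: lt_trans ne.
exists (fun z _ => ~ U z); last by move=> z; split=> [|[]//]; exists (fun=> 0%N).
move=> z_ z g_ g zz _ nU /Uo[e e0 H].
have [N hN] := zz e e0; apply: (nU N); apply: H => /=.
by rewrite dC; exact: hN.
Qed.

Lemma analytic_bigcup (B : nat -> set Z) :
  (forall n, analytic d (B n)) -> analytic d (\bigcup_n B n).
Proof.
move=> /(_ _)/cid2 aB; pose G n := sval (aB n).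
have Gc n : seq_closed d (G n) by rewrite /G; case: (aB n).
have GB n z : B n z <-> exists g, G n z g by rewrite /G; case: (aB n).
exists (fun z g => G (g 0%N) z (g \o S)).
  move=> z_ z g_ g zz gg H; have [N hN] := gg 0%N.
  apply: (Gc _ (fun n => z_ (n + N)%N) _ (fun n => g_ (n + N)%N \o S)).
  - move=> e /zz[N' hN']; exists N' => n N'n; apply: hN'.
    by rewrite (leq_trans N'n)// leq_addr.
  - move=> i; have [N' hN'] := gg i.+1; exists N' => n N'n; apply: hN'.
    by rewrite (leq_trans N'n)// leq_addr.
  - by move=> n; rewrite -(hN (n + N)%N) ?leq_addl//; exact: H.
move=> z; split=> [[n _ /GB[g Hg]]|[g Hg]].
  by exists (fun i => if i is j.+1 then g j else n).
by exists (g 0%N) => //; apply/GB; exists (g \o S).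
Qed.

Lemma analytic_bigcap (B : nat -> set Z) :
  (forall n, analytic d (B n)) -> analytic d (\bigcap_n B n).
Proof.
move=> /(_ _)/cid2 aB; pose G n := sval (aB n).
have Gc n : seq_closed d (G n) by rewrite /G; case: (aB n).
have GB n z : B n z <-> exists g, G n z g by rewrite /G; case: (aB n).
(* One code carries a code for every [B n], interleaved by the numbering of pairs. *)
exists (fun z g => forall n, G n z (fun k => g (pickle (n, k)))).
  move=> z_ z g_ g zz gg H n; apply: (Gc n z_ _ _ _ zz _ (fun m => H m n)).
  by move=> i; exact: gg.
move=> z; split=> [H|[g Hg] n _]; last first.
  by apply/GB; eexists; exact: Hg.
have /choice[g Hg] : forall n, exists g, G n z g by move=> n; apply/GB/H.
exists (fun m => if (unpickle m : option (nat * nat)) is Some (n, k) then g n k else 0%N).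
move=> n; rewrite (_ : (fun _ => _) = g n)//; apply/funext => k.
by rewrite pickleK.
Qed.

(** The sets that are analytic together with their complement form a sigma-algebra containing the
    open sets; analytic sets alone need not be stable under complement. *)
Lemma analytic_borel (B : set (borel Z)) : measurable B -> analytic d B.
Proof.
move=> mB.
suff : [set B : set Z | analytic d B /\ analytic d (~` B)] B by case.
move: B mB; apply: smallest_sub; last by move=> U /analytic_open.
split.
- by apply: analytic_open; exact: open0.
- by move=> A [aA aCA]; rewrite setTD /= setCK.
- move=> F H; split; first by apply: analytic_bigcup => n; case: (H n).
  by rewrite setC_bigcup; apply: analytic_bigcap => n; case: (H n).
Qed.

End analytic_sets.

(** * Selections with bounded codes *)

(** Dependent choice on finite prefixes. It serves the compactness of bounded codes, the least code
    and the capacity argument. *)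
Lemma branch_exists (P : seq nat -> Prop) :
  P [::] -> (forall s, P s -> exists m, P (rcons s m)) ->
  exists k, forall n, P (mkseq k n).
Proof.
move=> P0 PS.
have /choice[next Hn] : forall s, exists m, P s -> P (rcons s m).
  by move=> s; have [/PS[m]|nP] := pselect (P s); [exists m|exists 0%N].
pose sq n := iter n (fun s => rcons s (next s)) [::].
have sqE n : mkseq (next \o sq) n = sq n by elim: n => // n; rewrite mkseqS => ->.
exists (next \o sq) => n; rewrite sqE; elim: n => //= n; exact: Hn.
Qed.

(** Compactness of the codes below [k], in the manner of König: [g] is a cluster point of the
    [g_ j]. *)
Lemma bounded_branch (g_ : nat -> nat -> nat) (k : nat -> nat) :
  (forall i j, (i < j)%N -> (g_ j i <= k i)%N) ->
  exists g, forall n, exists2 j, (n <= j)%N & forall i, (i < n)%N -> g_ j i = g i.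
Proof.
move=> gk.
(* The prefix [s] is shared by infinitely many of the codes. *)
pose P s := forall N, exists2 j, (N <= j)%N &
  forall i, (i < size s)%N -> g_ j i = nth 0%N s i.
have P0 : P [::] by move=> N; exists N.
have PS s : P s -> exists m, P (rcons s m).
  move=> Ps; apply: contrapT => /forallNP nP.
  have /choice[N HN] : forall m, exists N, forall j, (N <= j)%N ->
      ~ forall i, (i < (size s).+1)%N -> g_ j i = nth 0%N (rcons s m) i.
    move=> m; have /existsNP[N /forall2NP H] := nP m.
    by exists N => j Nj; have [// |] := H j; rewrite size_rcons.
  (* An index beyond [M] exceeds [size s], so that [k] bounds the entry at position [size s], and
     exceeds [N m] for each of the finitely many values [m] allowed there. *)
  pose M := (maxn (size s).+1 (\max_(m < (k (size s)).+1) N m))%N.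
  have [j Mj js] := Ps M.
  have sj : (size s < j)%N by rewrite (leq_trans _ Mj)// leq_maxl.
  have mk : (g_ j (size s) < (k (size s)).+1)%N by rewrite ltnS gk.
  apply: (HN (g_ j (size s)) j).
    apply: (leq_trans _ Mj); apply: (leq_trans _ (leq_maxr _ _)).
    exact: (leq_bigmax (Ordinal mk)).
  move=> i; rewrite ltnS leq_eqVlt nth_rcons => /predU1P[->|ils].
    by rewrite ltnn eqxx.
  by rewrite ils js.
have [g Hg] := branch_exists _ P0 PS.
exists g => n; have [j nj Hj] := Hg n n; exists j => // i ilt.
by rewrite Hj ?size_mkseq// nth_mkseq.
Qed.

Section closed_relations.
Context {R : realType} {X : ptopologicalType} (d : X -> X -> R).
Hypotheses (dm : is_metric d) (dtop : metric_induces_topology d).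

Lemma cvg_metric_natSinv (x_ : nat -> X) x :
  (forall n, (d (x_ n) x < n.+1%:R^-1)%R) -> cvg_metric d x_ x.
Proof.
move=> H e /natSinv_lt[N Ne]; exists N => n Nn.
apply: lt_trans Ne; apply: lt_le_trans (H n) _.
by rewrite lef_pV2 ?posrE// ler_nat.
Qed.

Lemma seq_closed_measurable (T : set X) :
  (forall x_ x, cvg_metric d x_ x -> (forall n, T (x_ n)) -> T x) ->
  measurable (T : set (borel X)).
Proof.
move: dm => [d0 [dE [dC dT]]] HT.
rewrite -(setCK T); apply: measurableC; apply: sub_sigma_algebra.
apply/dtop => x nTx; apply: contrapT => /forall2NP H; apply: nTx.
have /choice[x_ Hx] : forall n : nat, exists y, (d y x < n.+1%:R^-1)%R /\ T y.
  move=> n; case: (H n.+1%:R^-1%R) => [n0|/existsNP[y /not_implyP[xy /contrapT Ty]]].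
    by case: n0; rewrite invr_gt0 ltr0n.
  by exists y; rewrite dC.
apply: HT (cvg_metric_natSinv x_ x _) _ => n; by case: (Hx n).
Qed.

(** A subsequence of the codes converges by [bounded_branch], and [G] is closed. Bounding only the
    first [j] entries of [g_ j] suits codes that are bounded one coordinate at a time. *)
Lemma seq_closed_bounded G x_ x g_ k : seq_closed d G -> cvg_metric d x_ x ->
  (forall n, G (x_ n) (g_ n)) ->
  (forall i j, (i < j)%N -> (g_ j i <= k i)%N) ->
  exists2 g, G x g & forall i, (g i <= k i)%N.
Proof.
move=> cG xx H gk; have [g Hg] := bounded_branch _ _ gk.
have /choice[j Hj] : forall n, exists j, (n <= j)%N /\
    forall i, (i < n)%N -> g_ j i = g i.
  by move=> n; have [j ? ?] := Hg n; exists j.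
exists g.
  apply: (cG (x_ \o j) x (g_ \o j) g) => [e /xx[N HN]|i|n /=]; last exact: H.
  - exists N => n Nn; apply: HN; apply: (leq_trans Nn); exact: (Hj n).1.
  - by exists i.+1 => n lin; exact: (Hj n).2.
move=> i; have [ij Hi] := Hj i.+1; rewrite -(Hi i)//; exact: gk.
Qed.

Definition section_prefix (G : X -> (nat -> nat) -> Prop) (k : nat -> nat)
    (s : seq nat) : set X :=
  [set x | exists g, [/\ G x g, forall i, (g i <= k i)%N &
     forall i, (i < size s)%N -> g i = nth 0%N s i]].

(** The set is closed: the codes below [k] are compact, and fixing a prefix is a closed
    condition. *)
Lemma measurable_section_prefix G k s : seq_closed d G ->
  measurable (section_prefix G k s : set (borel X)).
Proof.
move=> cG; apply: seq_closed_measurable => x_ x xx /choice[g_ Hg].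
pose G' x g := G x g /\ forall i, (i < size s)%N -> g i = nth 0%N s i.
have cG' : seq_closed d G'.
  move=> z_ z h_ h zz hh H; split; first by apply: cG zz hh _ => n; case: (H n).
  move=> i si; have [N hN] := hh i.
  by rewrite -(hN N)//; exact: (H N).2.
have [||g [Gxg gs] gk] := @seq_closed_bounded G' _ _ g_ k cG' xx.
- by move=> n; case: (Hg n).
- by move=> i j _; case: (Hg j).
by exists g.
Qed.

Lemma closed_selection G k : seq_closed d G ->
  exists sg : X -> nat -> nat,
    (forall x, section_prefix G k [::] x -> G x (sg x)) /\
    (forall n m, measurable ((section_prefix G k [::] `&` [set x | sg x n = m])
                             : set (borel X))).
Proof.
move=> cG; set T := section_prefix G k.
have Ttake x s i : T s x -> T (take i s) x.
  move=> [g [Gg gk gs]]; exists g; split => // l; rewrite size_take_min leq_min.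
  by move=> /andP[li ls]; rewrite nth_take// gs.
(* [P x s]: [s] begins the lexicographically least code of [x] in [G]. *)
pose P x s := T s x /\ forall i m, (i < size s)%N -> (m < nth 0%N s i)%N ->
   ~ T (rcons (take i s) m) x.
have /choice[sg Hsg] : forall x, exists k, T [::] x -> forall n, P x (mkseq k n).
  move=> x; have [Tx|] := pselect (T [::] x); last by exists (fun=> 0%N).
  have [||g Hg] := @branch_exists (P x); last by exists g.
    by split.
  move=> s [Ts Ps].
  have exm : exists m, `[< T (rcons s m) x >].
    case: Ts => g [Gg gk gs]; exists (g (size s)); apply/asboolP; exists g.
    split => // i; rewrite size_rcons ltnS nth_rcons leq_eqVlt.
    by move=> /predU1P[->|ils]; [rewrite ltnn eqxx|rewrite ils gs].
  case: (ex_minnP exm) => m /asboolP Tm mmin; exists m; split => // i l.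
  rewrite size_rcons ltnS nth_rcons leq_eqVlt => /predU1P[->|ils].
    rewrite ltnn eqxx -[rcons s m]cats1 take_size_cat// => lm /asboolP/mmin.
    by rewrite leqNgt lm.
  rewrite ils -[rcons s m]cats1 takel_cat ?(ltnW ils)//; exact: Ps.
(* At a first difference one of the two prefixes would have the larger entry and so not be least. *)
have Puniq x s s' : P x s -> P x s' -> size s = size s' -> s = s'.
  have aux s1 s2 i : P x s1 -> P x s2 -> (i < size s1)%N -> (i < size s2)%N ->
      take i s1 = take i s2 -> (nth 0 s2 i <= nth 0 s1 i)%N.
    move=> [T1 _] [_ P2] i1 i2 tE; rewrite leqNgt; apply/negP => lt12.
    by apply: (P2 i _ i2 lt12); rewrite -tE -take_nth//; exact: Ttake.
  move=> Ps Ps' ss'.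
  have tE i : (i <= size s)%N -> take i s = take i s'.
    elim: i => [|i IH] si; first by rewrite !take0.
    rewrite !(take_nth 0%N) -?ss'// IH 1?ltnW//; congr rcons.
    by apply/eqP; rewrite eqn_leq !aux -?ss'// IH// ltnW.
  by have := tE _ (leqnn _); rewrite {2}ss' !take_size.
have mP s : measurable ([set x | P x s] : set (borel X)).
  rewrite (_ : [set x | P x s] = T s `&` \bigcap_i \bigcap_m
    [set x | (i < size s)%N -> (m < nth 0%N s i)%N -> ~ T (rcons (take i s) m) x]).
    apply: measurableI; first exact: measurable_section_prefix.
    apply: bigcapT_measurable => i; apply: bigcapT_measurable => m.
    have [isz|isz] := boolP (i < size s)%N; last first.
      by rewrite (_ : [set _ | _] = setT)// -subTset.
    have [ms|ms] := boolP (m < nth 0 s i)%N; last first.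
      by rewrite (_ : [set _ | _] = setT)// -subTset.
    rewrite (_ : [set _ | _] = ~` T (rcons (take i s) m)).
      by apply: measurableC; exact: measurable_section_prefix.
    by apply/seteqP; split => x /=; [exact|move=> ? _].
  apply/seteqP; split => x; first by move=> [Ts Ps]; split => // i _ m _; exact: Ps.
  by move=> [Ts Ps]; split => // i m; exact: Ps.
exists sg; split.
  (* Every prefix of [sg x] extends to a code of [x] in [G]; these codes converge to [sg x], and [G]
     is closed. *)
  move=> x Tx; have /choice[g_ Hg] : forall n, exists g, G x g /\
      forall i, (i < n)%N -> g i = sg x i.
    move=> n; have [[g [Gg _ gs]] _] := Hsg x Tx n; exists g; split => // i ilt.
    by rewrite gs ?size_mkseq// nth_mkseq.
  apply: (cG (fun=> x) x g_).
  - by move: dm => [_ [dE _]] e e0; exists 0%N => n _; rewrite (iffRL (dE x x)).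
  - by move=> i; exists i.+1 => n ilt; exact: (Hg n).2.
  - by move=> n; exact: (Hg n).1.
move=> n m.
(* By uniqueness, [sg x n = m] means that the least prefix of length [n.+1] ends in [m], and there
   are countably many candidates for it. *)
rewrite (_ : _ `&` _ =
    \bigcup_(s : seq nat) [set x | size s = n /\ P x (rcons s m)]).
  apply: countable_bigcupT_measurable => // s.
  have [sn|sn] := eqVneq (size s) n.
    by rewrite (_ : [set _ | _] = [set x | P x (rcons s m)])//;
       apply/seteqP; split => x /= => [[]|].
  rewrite (_ : [set _ | _] = set0)// -subset0 => x [] /eqP.
  by rewrite (negbTE sn).
apply/seteqP; split => x.
  move=> [Tx] /= <-; exists (mkseq (sg x) n) => //; rewrite /= size_mkseq; split => //.
  by rewrite /= -mkseqS; exact: Hsg.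
move=> [s _ /= [sn Ps]]; have Tx : T [::] x by have := Ttake x _ 0%N Ps.1; rewrite take0.
split => //; have := Puniq x _ _ (Hsg x Tx n.+1) Ps.
rewrite size_mkseq size_rcons sn mkseqS => /(_ erefl).
by move=> /rcons_inj[_].
Qed.

End closed_relations.

(** * Capacity *)

Section outer.
Context d (T : measurableType d) (R : realType) (eta : probability T R).

Definition outer (S : set T) : \bar R :=
  ereal_inf [set eta H | H in [set H | measurable H /\ S `<=` H]].

Lemma outer_le S H : measurable H -> S `<=` H -> outer S <= eta H.
Proof. by move=> mH SH; apply: ereal_inf_lbound; exists H. Qed.

Lemma outer_le1 S : outer S <= 1.
Proof. by rewrite -(probability_setT eta); apply: outer_le. Qed.

Lemma outer_ge0 S : 0 <= outer S.
Proof. by apply: le_ereal_inf_tmp => _ [H [mH _] <-]; exact: measure_ge0. Qed.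

Lemma outer_fin S : outer S \is a fin_num.
Proof.
by rewrite ge0_fin_numE ?outer_ge0// (le_lt_trans (outer_le1 S))// ltry.
Qed.

Lemma outer_lt S (r : \bar R) : outer S < r ->
  exists2 H, measurable H & S `<=` H /\ eta H < r.
Proof. by move=> /ereal_inf_lt[_ [H [mH SH] <-] Hr]; exists H. Qed.

(** Continuity from below holds for arbitrary sets: replacing measurable covers [U n] by the
    intersections [V n] of all later ones makes them increase while they still cover [A n]. *)
Lemma outer_bigcup (A : nat -> set T) (r : R) :
  (forall m n, (m <= n)%N -> A m `<=` A n) ->
  r%:E < outer (\bigcup_n A n) -> exists n, r%:E < outer (A n).
Proof.
move=> ndA rA; apply: contrapT => /forallNP H.
pose o := fine (outer (\bigcup_n A n)); pose r' := ((r + o) / 2)%R.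
have oE : outer (\bigcup_n A n) = o%:E by rewrite fineK// outer_fin.
have ro : (r < o)%R by rewrite -lte_fin -oE.
have [rr' r'o] := midf_lt ro.
have /choice[U HU] : forall n, exists U, measurable U /\ A n `<=` U /\ eta U < r'%:E.
  move=> n; have [|U mU HU] := @outer_lt (A n) r'%:E; last by exists U.
  by apply: (@le_lt_trans _ _ r%:E); rewrite ?lte_fin// leNgt; apply/negP/H.
pose V n := \bigcap_(j in [set j | (n <= j)%N]) U j.
have mV n : measurable (V n) by apply: bigcap_measurableType => j _; case: (HU j).
have Vr n : eta (V n) <= r'%:E.
  apply/ltW/(le_lt_trans _ (HU n).2.2); apply: le_measure; rewrite ?inE//.
    by case: (HU n).
  by move=> x; apply => /=.
have ndV : nondecreasing_seq V.
  by move=> m n mn; apply/subsetPset => x Vx j /= nj; apply: Vx; exact: leq_trans nj.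
have : eta (\bigcup_n V n) <= r'%:E.
  apply: cvge_le (nondecreasing_cvg_mu mV (bigcupT_measurable _ mV) ndV).
  exact: nearW.
apply/negP; rewrite -ltNge; apply: (@lt_le_trans _ _ (outer (\bigcup_n A n))).
  by rewrite oE lte_fin.
apply: outer_le; first exact: bigcupT_measurable.
move=> x [n _ Anx]; exists n => // j /= nj; apply: (HU j).2.1.
exact: ndA Anx.
Qed.

End outer.
Arguments outer {d T R} eta S.

Section capacity.
Context {R : realType} {X : ptopologicalType} (d : X -> X -> R).
Hypotheses (dm : is_metric d) (dtop : metric_induces_topology d).
Context (eta : prob X R).

Lemma analytic_inner_approx G (r : R) : seq_closed d G ->
  r%:E < outer eta ([set x | exists g, G x g] : set (borel X)) ->
  exists k, r%:E <= eta (section_prefix G k [::]).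
Proof.
move=> cG rA; move: (dm) => [d0 [dE [dC dT]]].
pose S (s : seq nat) : set (borel X) :=
  [set x | exists2 g, G x g & forall i, (i < size s)%N -> (g i <= nth 0 s i)%N].
(* The codes are bounded one coordinate at a time, keeping the outer measure
   above [r]. *)
have [||k Hk] := @branch_exists (fun s => r%:E < outer eta (S s)).
- rewrite (_ : S [::] = [set x | exists g, G x g])//.
  by apply/seteqP; split => x [g Gg]; exists g.
- move=> s rs; have [||m rm] := @outer_bigcup _ _ _ eta (fun m => S (rcons s m)) r.
  + move=> m n mn x [g Gg gs]; exists g => // i; rewrite size_rcons ltnS => ilt.
    have := gs i; rewrite size_rcons ltnS => /(_ ilt); rewrite !nth_rcons.
    by case: ifP => // _; case: ifP => // _ /leq_trans; exact.
  + rewrite (_ : \bigcup_n _ = S s)//; apply/seteqP; split => x.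
      move=> [m _ [g Gg gs]]; exists g => // i ilt.
      by have := gs i; rewrite size_rcons nth_rcons ilt; apply; exact: ltnW.
    move=> [g Gg gs]; exists (g (size s)) => //; exists g => // i.
    rewrite size_rcons ltnS leq_eqVlt nth_rcons => /predU1P[->|isz].
      by rewrite ltnn eqxx.
    by rewrite isz gs.
  + by exists m.
exists k.
pose C n : set (borel X) := [set x | forall e : R, (0 < e)%R ->
  exists2 y, S (mkseq k n) y & (d x y < e)%R].
have mC n : measurable (C n).
  apply: seq_closed_measurable dm dtop _ _ => x_ x xx Cx e e0.
  have e20 : (0 < e / 2)%R by rewrite divr_gt0.
  have [N /(_ N (leqnn _)) HN] := xx _ e20.
  have [y Sy xy] := Cx N _ e20; exists y => //.
  by rewrite (le_lt_trans (dT _ (x_ N) _))// (dC x) [ltRHS](splitr e) ltrD.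
have SS m n : (m <= n)%N -> S (mkseq k n) `<=` S (mkseq k m).
  move=> mn x [g Gg gs]; exists g => // i; rewrite size_mkseq => im.
  have := gs i; rewrite size_mkseq nth_mkseq//; last exact: leq_trans mn.
  by rewrite nth_mkseq//; apply; exact: leq_trans mn.
have niC : nonincreasing_seq C.
  move=> m n mn; apply/subsetPset => x Cx e /Cx[y Sy xy].
  by exists y => //; exact: SS Sy.
have rC n : r%:E <= eta (C n).
  apply/ltW/(lt_le_trans (Hk n))/outer_le => // x Sx e e0.
  by exists x => //; rewrite (iffRL (dE x x)).
(* The [S (mkseq k n)] need not be measurable, but the intersection of their
   closures already lies in the projection of the bounded codes. *)
have CT : \bigcap_n C n `<=` section_prefix G k [::].
  move=> x Cx.
  have /choice[x_ Hx] : forall n : nat, exists y, S (mkseq k n) y /\ (d y x < n.+1%:R^-1)%R.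
    move=> n; have [|y Sy xy] := Cx n I n.+1%:R^-1%R.
      by rewrite invr_gt0 ltr0n.
    by exists y; rewrite dC.
  (* As [x_ n] lies in [S (mkseq k n)], it has a code bounded by [k] on the first [n] entries, which
     is what [seq_closed_bounded] asks. *)
  have /choice[g_ Hg] : forall n, exists g, G (x_ n) g /\ forall i, (i < n)%N -> (g i <= k i)%N.
    move=> n; have [[g Gg gs] _] := Hx n; exists g; split => // i ilt.
    by have := gs i; rewrite size_mkseq nth_mkseq//; exact.
  have [|||g Gg gk] := seq_closed_bounded d G x_ x g_ k cG.
  + by apply: cvg_metric_natSinv => n; case: (Hx n).
  + by move=> n; case: (Hg n).
  + by move=> i j ij; exact: (Hg j).2.
  by exists g; split.
apply: (@le_trans _ _ (eta (\bigcap_n C n))); last first.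
  apply: le_measure => //; rewrite inE; first exact: bigcapT_measurable.
  exact: measurable_section_prefix.
apply: (cvge_ge _ (nonincreasing_cvg_mu _ mC (bigcapT_measurable mC) niC)).
- exact: nearW.
- by rewrite (le_lt_trans (probability_le1 _ _))// ltry.
Qed.

End capacity.

(** * Measurable selections in Polish spaces *)

Section metric_product.
Context {R : realType} {X : ptopologicalType} (d : X -> X -> R).
Hypotheses (dm : is_metric d) (dtop : metric_induces_topology d).

Definition prod_metric (p q : pprod X X) : R := (d p.1 q.1 + d p.2 q.2)%R.

Lemma prod_metric_is_metric : is_metric prod_metric.
Proof.
move: dm => [d0 [dE [dC dT]]]; rewrite /prod_metric; split => [p q|].
  by rewrite addr_ge0.
split=> [[x y] [x' y'] /=|]; last split => [p q|p q r].
- split=> [/eqP|[-> ->]]; last by rewrite !(iffRL (dE _ _))// addr0.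
  by rewrite paddr_eq0// => /andP[/eqP/dE -> /eqP/dE ->].
- by rewrite dC [X in (_ + X)%R]dC.
- by rewrite addrACA lerD.
Qed.

Lemma metric_ball_nbhs (x : X) (e : R) : (0 < e)%R -> nbhs x [set y | (d x y < e)%R].
Proof.
move: dm => [d0 [dE [dC dT]]] e0; apply: open_nbhs_nbhs; split; last first.
  by rewrite /= (iffRL (dE x x)).
apply/dtop => y /= xy; exists (e - d x y)%R; first by rewrite subr_gt0.
by move=> z /= yz; rewrite (le_lt_trans (dT _ y _))// addrC -ltrBrDr.
Qed.

Lemma nbhs_metric_ball (x : X) (A : set X) : nbhs x A ->
  exists2 e : R, (0 < e)%R & [set y | (d x y < e)%R] `<=` A.
Proof.
rewrite nbhsE => -[U [/dtop Uo Ux] UA].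
by have [e e0 H] := Uo x Ux; exists e => //; exact: subset_trans UA.
Qed.

Lemma prod_metric_topology : metric_induces_topology prod_metric.
Proof.
move: (dm) => [d0 [dE [dC dT]]] U; split => [Uo [x y] Uxy|H].
  have : nbhs ((x, y) : pprod X X) U by exact: open_nbhs_nbhs.
  move=> [[A B] [/= /nbhs_metric_ball[a a0 HA] /nbhs_metric_ball[b b0 HB]] AB].
  exists (Num.min a b); first by rewrite lt_min a0.
  move=> [x' y'] /=; rewrite /prod_metric /= lt_min => /andP[xa yb].
  apply: AB; split => /=.
    by apply: HA; rewrite /= (le_lt_trans _ xa)// lerDl.
  by apply: HB; rewrite /= (le_lt_trans _ yb)// lerDr.
rewrite openE => -[x y] /H[e e0 He].
have e20 : (0 < e / 2)%R by rewrite divr_gt0.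
exists ([set x' | (d x x' < e / 2)%R], [set y' | (d y y' < e / 2)%R]).
  by split; exact: metric_ball_nbhs.
move=> [x' y'] [/= xx yy]; apply: He.
by rewrite /= /prod_metric [ltRHS](splitr e) ltrD.
Qed.

Lemma cvg_prod_metric u z : cvg_metric d (fst \o u) z.1 ->
  cvg_metric d (snd \o u) z.2 -> cvg_metric prod_metric u z.
Proof.
move=> c1 c2 e e0; have e20 : (0 < e / 2)%R by rewrite divr_gt0.
have [N1 H1] := c1 _ e20; have [N2 H2] := c2 _ e20.
exists (maxn N1 N2) => n; rewrite geq_max => /andP[n1 n2].
by rewrite /prod_metric [ltRHS](splitr e) ltrD//; [exact: H1|exact: H2].
Qed.

End metric_product.

Section polish_space.
Context {R : realType} {X : ptopologicalType} (d : X -> X -> R) (q : nat -> X).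
Hypotheses (dm : is_metric d) (dtop : metric_induces_topology d).
Hypothesis (qd : forall x (e : R), (0 < e)%R -> exists n, (d x (q n) < e)%R).

(** By separability an open set of the product is a countable union of products of balls centred at
    points of [q], so measurability can be checked coordinatewise. *)
Lemma measurable_fun_pprod dT (T : measurableType dT) (f g : T -> borel X) :
  measurable_fun [set: T] f -> measurable_fun [set: T] g ->
  measurable_fun [set: T] ((fun t => (f t, g t)) : T -> borel (pprod X X)).
Proof.
move: (dm) => [d0 [dE [dC dT']]] mf mg.
apply: (@measurability _ _ T (borel (pprod X X)) setT _ (@open (pprod X X))) => // _ [U Uo <-].
have mball (h : T -> borel X) x (e : R) : measurable_fun [set: T] h ->
    measurable ([set t : T | (d x (h t) < e)%R]).
  move=> mh; rewrite -[X in measurable X]setTI.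
  apply: (mh measurableT [set y : borel X | (d x y < e)%R]); apply: sub_sigma_algebra.
  apply/dtop => y /= xy; exists (e - d x y)%R; first by rewrite subr_gt0.
  by move=> z /= yz; rewrite (le_lt_trans (dT' _ y _))// addrC -ltrBrDr.
pose inU n m i := forall x y, (d (q n) x < i.+1%:R^-1)%R ->
   (d (q m) y < i.+1%:R^-1)%R -> U (x, y).
rewrite setTI (_ : _ @^-1` _ = \bigcup_n \bigcup_m \bigcup_i
  ([set t | inU n m i] `&` ([set t | (d (q n) (f t) < i.+1%:R^-1)%R] `&`
    [set t | (d (q m) (g t) < i.+1%:R^-1)%R]))).
  apply: bigcupT_measurable => n; apply: bigcupT_measurable => m.
  apply: bigcupT_measurable => i; apply: measurableI; last first.
    by apply: measurableI; exact: mball.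
  have [H|H] := pselect (inU n m i).
    by rewrite (_ : [set _ | _] = setT)//; apply/seteqP; split.
  by rewrite (_ : [set _ | _] = set0)//; apply/seteqP; split.
apply/seteqP; split => t /=; last first.
  by move=> [n _ [m _ [i _ [H [ft gt]]]]]; exact: H.
have H := (prod_metric_topology d dm dtop U).1 Uo.
move=> /H[e e0 He].
(* Each coordinate passes through a centre and moves by two radii; four radii in all stay below
   [e]. *)
have e40 : (0 < e / 4)%R by rewrite divr_gt0.
have [i ie] := natSinv_lt _ e40.
have i0 : (0 < i.+1%:R^-1 :> R)%R by rewrite invr_gt0 ltr0n.
have [n fn] := qd (f t) _ i0; have [m gm] := qd (g t) _ i0.
exists n => //; exists m => //; exists i => //; split.
  move=> x y nx my; apply: He; rewrite /= /prod_metric /=.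
  have := dT' (f t) (q n) x; have := dT' (g t) (q m) y.
  move: (lt_trans fn ie) (lt_trans gm ie) (lt_trans nx ie) (lt_trans my ie).
  by move=> h1 h2 h3 h4 h5 h6; lra.
by rewrite /= dC fn dC gm.
Qed.

Hypothesis dc : metric_complete d.

Lemma analytic_projection (B : set (pprod X X)) : analytic (prod_metric d) B ->
  exists2 G : X -> (nat -> nat) -> Prop, seq_closed d G &
    (forall x g, G x g -> exists2 y, B (x, y) &
       forall i, (d y (q (g i.*2)) <= i.+1%:R^-1)%R) /\
    (forall x y, B (x, y) -> exists g, G x g).
Proof.
move: (dm) => [d0 [dE [dC dT]]] [G cG GB].
(* Odd entries of the code witness [B (x, y)]; even entries locate [y] through
   the dense sequence [q]. *)
exists (fun x g => exists2 y, G (x, y) (fun i => g i.*2.+1) &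
  forall i, (d y (q (g i.*2)) <= i.+1%:R^-1)%R); last first.
  split=> [x g [y Gxy yq]|x y /GB[g Gg]].
    by exists y => //; apply/GB; eexists; exact: Gxy.
  have /choice[b Hb] : forall i : nat, exists n, (d y (q n) < i.+1%:R^-1)%R.
    by move=> i; apply: qd; rewrite invr_gt0 ltr0n.
  exists (fun m => if odd m then g m./2 else b m./2); exists y.
    rewrite (_ : (fun _ => _) = g)//; apply/funext => i /=.
    by rewrite odd_double /= uphalf_double.
  by move=> i; rewrite odd_double doubleK ltW.
move=> x_ x g_ g xx gg /(_ _)/cid2-H; pose y_ n := sval (H n).
have Gy n : G (x_ n, y_ n) (fun i => g_ n i.*2.+1) by rewrite /y_; case: (H n).
have yq n i : (d (y_ n) (q (g_ n i.*2)) <= i.+1%:R^-1)%R by rewrite /y_; case: (H n).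
have yq' i : exists N, forall n, (N <= n)%N -> (d (y_ n) (q (g i.*2)) <= i.+1%:R^-1)%R.
  by have [N HN] := gg i.*2; exists N => n /HN <-.
(* The even entries of the codes stabilize, so for each [i] the points [y_ n] eventually lie within
   1/(i+1) of one point of [q]; they form a Cauchy sequence. *)
have [|y yy] := dc y_.
  move=> e e0; have e20 : (0 < e / 2)%R by rewrite divr_gt0.
  have [i ie] := natSinv_lt _ e20; have [N HN] := yq' i.
  exists N => m n /HN Hm /HN Hn; apply: (le_lt_trans (dT _ (q (g i.*2)) _)).
  by rewrite [ltRHS](splitr e) (dC (q _)) ltrD// (le_lt_trans _ ie).
exists y.
  apply: (cG (fun n => (x_ n, y_ n)) _ (fun n i => g_ n i.*2.+1)) => //.
    exact: cvg_prod_metric.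
move=> i; apply/ler_addgt0Pr => e /yy[N HN]; have [N' HN'] := yq' i.
apply: (le_trans (dT _ (y_ (maxn N N')) _)); rewrite addrC lerD//.
  by apply: HN'; rewrite leq_maxr.
by rewrite dC ltW//; apply: HN; rewrite leq_maxl.
Qed.

(** The projection [S] of [B] may fail to be Borel. It is enclosed between [A], the points having a
    code in the compact box, and a measurable cover [H0]; [H] is their difference. *)
Lemma measurable_selection (eta : prob X R) (B : set (borel (pprod X X))) (e : R) :
  measurable B -> (0 < e)%R ->
  exists A s H, [/\ measurable (A : set (borel X)),
    measurable_fun [set: borel X] (s : borel X -> borel X),
    forall x, A x -> B (x, s x) &
    [/\ measurable (H : set (borel X)), eta H <= e%:E &
    forall x y, B (x, y) -> A x \/ H x]].
Proof.
move: (dm) => [d0 [dE [dC dT]]] mB e0.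
have aB : analytic (prod_metric d) B.
  by apply: analytic_borel => //;
     [exact: prod_metric_is_metric|exact: prod_metric_topology].
have [G cG [GB BG]] := analytic_projection _ aB.
pose S : set (borel X) := [set x | exists g, G x g].
have So := outer_fin _ _ _ eta S; pose o := fine (outer eta S).
have oE : outer eta S = o%:E by rewrite fineK.
have e20 : (0 < e / 2)%R by rewrite divr_gt0.
have [|k Hk] := @analytic_inner_approx _ _ d dm dtop eta G (o - e / 2)%R cG.
  by rewrite oE lte_fin ltrBlDr ltrDl.
have [|H0 mH0 [SH0 H0o]] := @outer_lt _ _ _ eta S (o + e / 2)%:E.
  by rewrite oE lte_fin ltrDl.
set A := section_prefix G k [::] in Hk.
have mA : measurable (A : set (borel X)) by exact: measurable_section_prefix.
have [sg [Gsg msg]] := closed_selection d dm dtop G k cG.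
have /choice[y Hy] : forall x, exists y, A x -> B (x, y) /\
    forall i, (d y (q (sg x i.*2)) <= i.+1%:R^-1)%R.
  move=> x; have [/Gsg/GB[y]|nA] := pselect (A x); last by exists point.
  by exists y.
(* Off [A] the map is the identity. The exceptional set has measure at most (o + e/2) - (o - e/2) =
   e. *)
exists A, (fun x => if x \in A then y x else x), (H0 `\` A); split => //.
- apply: (@measurability _ _ (borel X) (borel X) setT _ (@open X)) => // _ [U Uo <-]; rewrite setTI.
  (* For [x] in [A], [y x] lies in the open [U] exactly when for some [i] the closed ball of radius
     1/(i+1) about [q (sg x i.*2)] lies in [U], a condition on a single entry of the code. *)
  pose inU i m := forall z, (d z (q m) <= i.+1%:R^-1)%R -> U z.
  rewrite (_ : _ @^-1` _ = (U `\` A) `|` \bigcup_i \bigcup_m ([set x | inU i m] `&`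
     (A `&` [set x | sg x i.*2 = m]))).
    apply: measurableU.
      by apply: measurableD => //; exact: sub_sigma_algebra.
    apply: bigcupT_measurable => i; apply: bigcupT_measurable => m.
    apply: measurableI; last exact: msg.
    have [iH|nH] := pselect (inU i m).
      by rewrite (_ : [set _ | _] = setT)//; apply/seteqP; split.
    by rewrite (_ : [set _ | _] = set0)//; apply/seteqP; split.
  apply/seteqP; split => x /=.
    case: ifPn => xA; last by rewrite notin_setE in xA; left.
    move: Uo => /dtop Uo /Uo[r r0 Hr]; right.
    have [Bxy yq] := Hy x (set_mem xA).
    have r20 : (0 < r / 2)%R by rewrite divr_gt0.
    have [i ir] := natSinv_lt _ r20.
    exists i => //; exists (sg x i.*2) => //; split; last by split => //; exact: set_mem.
    move=> z zq; apply: Hr => /=; have := yq i.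
    have := dT (y x) (q (sg x i.*2)) z; rewrite (dC (q _) z).
    move: (le_lt_trans zq ir) => h0 h1 /le_lt_trans/(_ ir) h2.
    by lra.
  move=> [[Ux nAx]|[i _ [m _ [iU [Ax xm]]]]]; first by rewrite memNset.
  by rewrite mem_set//; apply: iU; rewrite -xm; exact: (Hy x Ax).2.
- by move=> x Ax; rewrite mem_set//; exact: (Hy x Ax).1.
split; first exact: measurableD.
  have AH0 : A `<=` H0.
    by move=> x [g [Gg _ _]]; apply: SH0; exists g.
  have fA : eta A \is a fin_num by exact: fin_num_measure.
  have fH : eta H0 \is a fin_num by exact: fin_num_measure.
  have -> : eta (H0 `\` A) = eta H0 - eta A.
    rewrite measureD//; first by rewrite setIidr.
    by rewrite -ge0_fin_numE.
  move: Hk H0o; rewrite -(fineK fA) -(fineK fH) lee_fin lte_fin -EFinB lee_fin.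
  by move=> h1 h2; lra.
move=> x y0 /BG Sx; have [Ax|nAx] := pselect (A x); [by left|right].
by split => //; exact: SH0.
Qed.

End polish_space.

(** * Integrals of extended real functions *)

Section integral_facts.
Context {d : measure_display} {T : measurableType d} {R : realType}.
Context (mu : {measure set T -> \bar R}).
Implicit Types f g : T -> \bar R.

Lemma ae_le_integral f g : measurable_fun [set: T] f -> measurable_fun [set: T] g ->
  {ae mu, forall x, f x <= g x} -> \int[mu]_x f x <= \int[mu]_x g x.
Proof.
move=> mf mg fg; rewrite integralE [leRHS]integralE; apply: leeB.
  apply: ae_ge0_le_integral => //; try exact: measurable_funepos.
  apply: filterS fg => x fg _; by rewrite !funeposE ge_max !le_max fg lexx orbT.
apply: ae_ge0_le_integral => //; try exact: measurable_funeneg.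
apply: filterS fg => x fg _; by rewrite !funenegE ge_max !le_max leeN2 fg lexx orbT.
Qed.

Lemma le_integral_measurable f g : measurable_fun [set: T] f ->
  measurable_fun [set: T] g -> (forall x, f x <= g x) ->
  \int[mu]_x f x <= \int[mu]_x g x.
Proof. by move=> mf mg fg; apply: ae_le_integral => //; exact: aeW. Qed.

(** Change of variables, in a form that serves the marginals of a coupling, the law of a graph and,
    with [phi] the identity, the completion of a measure. *)
Lemma integral_transfer d' (T' : measurableType d')
    (nu : {measure set T' -> \bar R}) (phi : T -> T') (f : T' -> \bar R) :
  measurable_fun [set: T] phi ->
  (forall A, measurable A -> mu (phi @^-1` A) = nu A) ->
  measurable_fun [set: T'] f -> \int[nu]_y f y = \int[mu]_x f (phi x).
Proof.
move=> mphi munu mf.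
pose phi_mixin := isMeasurableFun.Build _ _ _ _ _ mphi.
pose phi' : {mfun T >-> T'} := HB.pack phi phi_mixin.
have H (g : T' -> \bar R) : measurable_fun [set: T'] g -> (forall y, 0 <= g y) ->
    \int[nu]_y g y = \int[mu]_x g (phi x).
  move=> mg g0; transitivity (\int[pushforward mu phi']_y g y); last first.
    by rewrite ge0_integral_pushforward.
  by apply: (eq_measure_integral (pushforward mu phi')) => A mA _; rewrite -munu.
rewrite integralE [RHS]integralE; congr (_ - _).
  rewrite (H _ (measurable_funepos mf) (fun=> funepos_ge0 _ _)).
  by apply: eq_integral => x _; rewrite !funeposE.
rewrite (H _ (measurable_funeneg mf) (fun=> funeneg_ge0 _ _)).
by apply: eq_integral => x _; rewrite !funenegE.
Qed.

Lemma integralZl_pos f (r : R) : (0 < r)%R -> measurable_fun [set: T] f ->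
  \int[mu]_x (r%:E * f x) = r%:E * \int[mu]_x f x.
Proof.
move=> r0 mf; rewrite integralE [in RHS]integralE.
rewrite ge0_funeposM ?ltW// ge0_funenegM ?ltW//.
have r0' : 0 <= r%:E by rewrite lee_fin ltW.
rewrite !ge0_integralZl//; try exact: measurable_funepos; try exact: measurable_funeneg.
have muleB a b : 0 <= b -> r%:E * a - r%:E * b = r%:E * (a - b).
  move=> b0; have [->|bn] := eqVneq b +oo.
    by rewrite gt0_muley ?lte_fin// !addeNy gt0_muleNy ?lte_fin.
  rewrite muleBr//; apply: fin_num_adde_defl.
  by rewrite fin_numN ge0_fin_numE ?ltey.
by apply: muleB; exact: integral_ge0.
Qed.

Lemma integrable_posneg f : measurable_fun [set: T] f ->
  \int[mu]_x f^\+ x < +oo -> \int[mu]_x f^\- x < +oo ->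
  mu.-integrable [set: T] f.
Proof.
move=> mf fp fn; apply/integrableP; split => //.
rewrite (eq_integral (f^\+ \+ f^\-)); last first.
  by move=> x _; exact: (congr1 (@^~ x) (fune_abse f)).
rewrite ge0_integralD//; try exact: measurable_funepos; try exact: measurable_funeneg.
exact: lte_add_pinfty.
Qed.

(* No integrability of [f] is needed because [+oo - +oo = -oo] here: the left-hand
   side is [-oo] as soon as the negative part of [f] has infinite integral. *)
Lemma le_integralB f g : measurable_fun [set: T] f -> measurable_fun [set: T] g ->
  (forall x, 0 <= g x) -> \int[mu]_x g x < +oo ->
  \int[mu]_x f x - \int[mu]_x g x <= \int[mu]_x (f x - g x).
Proof.
move=> mf mg g0 gfin.
have mfg : measurable_fun [set: T] (fun x => f x - g x) by exact: emeasurable_funB.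
have ig : mu.-integrable [set: T] g.
  apply/integrableP; split => //.
  by under eq_integral do rewrite gee0_abs//.
have ig_fin : \int[mu]_x g x \is a fin_num.
  by rewrite ge0_fin_numE// integral_ge0.
have mfp := measurable_funepos mf; have mfn := measurable_funeneg mf.
have [fn|fn] := eqVneq (\int[mu]_x f^\- x) +oo.
  by rewrite integralE fn addeNy addNye leNye.
have fnfin : \int[mu]_x f^\- x < +oo by rewrite ltey.
have [fp|fp] := eqVneq (\int[mu]_x f^\+ x) +oo; last first.
  have fpfin : \int[mu]_x f^\+ x < +oo by rewrite ltey.
  rewrite -integralB//; exact: integrable_posneg.
have g_ge0 x : [set: T] x -> 0 <= g x by [].
have maxN (z : \bar R) : maxe z 0 != -oo.
  by rewrite -ltNye lt_max ltNyr orbT.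
(* In the remaining case the positive part of [f] has infinite integral and the negative part a
   finite one. Comparing the parts of [f - g] with those of [f], up to [g], gives [f - g] the
   integral [+oo]. *)
have Hp : \int[mu]_x f^\+ x <= \int[mu]_x (fun x => f x - g x)^\+ x + \int[mu]_x g x.
  rewrite -ge0_integralD//; last exact: measurable_funepos.
  apply: ge0_le_integral => //.
    by apply: emeasurable_funD => //; exact: measurable_funepos.
  move=> x _; rewrite !funeposE; move: (g0 x).
  case: (f x) => [r| |]; case: (g x) => [s| |] //=.
  - rewrite -EFinB -!EFin_max -EFinD !lee_fin => s0.
    by rewrite ge_max; case: (leP (r - s)%R 0%R) => h; apply/andP; split; lra.
  - by move=> _; rewrite addey ?maxN// leey.
  - by move=> _; rewrite addey ?maxN// leey.
  - by move=> s0; rewrite addNye maxNye add0e.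
  - by move=> _; rewrite addey ?maxN// leey.
have Hn : \int[mu]_x (fun x => f x - g x)^\- x <= \int[mu]_x f^\- x + \int[mu]_x g x.
  rewrite -ge0_integralD//.
  apply: ge0_le_integral => //.
  - exact: measurable_funeneg.
  - by apply: emeasurable_funD => //; exact: measurable_funeneg.
  move=> x _; rewrite !funenegE; move: (g0 x).
  case: (f x) => [r| |]; case: (g x) => [s| |] //= s0;
    rewrite ?addey ?maxN ?leey ?maxNye ?add0e//.
    move: s0; rewrite -?EFinN -!EFin_max -?EFinD !lee_fin => s0.
    by rewrite ge_max; case: (leP (- r)%R 0%R) => h; apply/andP; split; lra.
have -> : \int[mu]_x (f x - g x) = +oo; last exact: leey.
rewrite integralE.
have -> : \int[mu]_x (fun x => f x - g x)^\+ x = +oo.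
  apply/eqP; move: Hp; rewrite fp leye_eq.
  by move: ig_fin; case: (\int[mu]_x g x) => // s _; case: (integral _ _ _).
rewrite addye// eqe_oppLR /= -ltey (le_lt_trans Hn)//.
exact: lte_add_pinfty.
Qed.

End integral_facts.

(** * Countable families of measurable selections *)

Lemma lsc_measurable {R : realType} {T : ptopologicalType} (f : T -> \bar R) :
  lsc f -> measurable_fun [set: borel T] (f : borel T -> \bar R).
Proof.
move=> cf; apply: (measurability _ (ErealGenOInfty.measurableE R)).
move=> _ [_ [a ->]] <-; rewrite setTI; apply: sub_sigma_algebra.
by rewrite preimage_itvoy; exact: cf.
Qed.

(** The first index [n] with [F n x] cuts [T] into countably many measurable pieces, and on each
    piece the glued map is a single [s n]. *)
Lemma measurable_fun_first d d' (T : measurableType d) (T' : measurableType d')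
    (F : nat -> set T) (s : nat -> T -> T') :
  (forall n, measurable (F n)) -> (forall n, measurable_fun [set: T] (s n)) ->
  (forall x, exists n, F n x) ->
  exists2 sg, measurable_fun [set: T] sg & forall x, exists2 n, F n x & sg x = s n x.
Proof.
move=> mF ms cov.
have cov' x : exists n, `[< F n x >] by have [n ?] := cov x; exists n; apply/asboolP.
pose k x := ex_minn (cov' x).
have Fk x : F (k x) x by rewrite /k; case: ex_minnP => m /asboolP.
have kmin x n : F n x -> (k x <= n)%N.
  by rewrite /k; case: ex_minnP => m _ mn /asboolP/mn.
exists (fun x => s (k x) x); last by move=> x; exists (k x).
move=> _ Y mY; rewrite setTI.
rewrite (_ : _ @^-1` _ = \bigcup_n ((F n `\` \big[setU/set0]_(i < n) F i) `&` (s n @^-1` Y))).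
  apply: bigcupT_measurable => n; apply: measurableI.
    by apply: measurableD => //; exact: bigsetU_measurable.
  by rewrite -[X in measurable X]setTI; exact: ms.
apply/seteqP; split => x /=.
  move=> Yx; exists (k x) => //; split => //; split => //.
  rewrite -bigcup_mkord => -[i /= ik /kmin]; by rewrite leqNgt ik.
move=> [n _ [[Fn nF] Yn]]; suff -> : k x = n by [].
apply/eqP; rewrite eqn_leq kmin//= leqNgt; apply/negP => kn; apply: nF.
by rewrite -bigcup_mkord; exists (k x).
Qed.

Lemma polish_metric (R : realType) (X : ptopologicalType) : polish R X ->
  exists (d : X -> X -> R) (q : nat -> X),
    [/\ is_metric d, metric_induces_topology d, metric_complete d &
     forall x (e : R), (0 < e)%R -> exists n, (d x (q n) < e)%R].
Proof.
move=> [[S [/countable_injP[i iI] Sd]] [d [dm [dtop dc]]]].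
have /choice[q Hq] : forall n, exists z, forall x, S x -> i x = n -> z = x.
  move=> n; have [[x Sx ixn]|H] := pselect (exists2 x, S x & i x = n).
    exists x => y Sy iyn; apply: iI; rewrite ?inE//; by rewrite ixn iyn.
  by exists point => x Sx ixn; exfalso; apply: H; exists x.
exists d, q; split => // x e e0.
have : closure S x by rewrite Sd.
move=> /(_ _ (metric_ball_nbhs d dm dtop x e e0))[y [Sy xy]].
by exists (i y); rewrite (Hq (i y) y).
Qed.

Section selections.
Context {R : realType} {X : ptopologicalType} (pol : polish R X).

Lemma measurable_graph (s : borel X -> borel X) : measurable_fun [set: borel X] s ->
  measurable_fun [set: borel X] ((fun x => (x, s x)) : borel X -> borel (pprod X X)).
Proof.
move=> ms; have [d [q [dm dtop _ dq]]] := polish_metric _ _ pol.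
exact: (measurable_fun_pprod d q dm dtop dq).
Qed.

(** The superlevel sets of [f] at rational levels are selected from with every tolerance 1/(k+1).
    Failing at one level for all tolerances has measure 0. The identity is put first so that staying
    in place is always among the moves. *)
Lemma countable_selection (eta : prob X R) (f : pprod X X -> \bar R) :
  measurable_fun [set: borel (pprod X X)] (f : borel (pprod X X) -> \bar R) ->
  exists (s : nat -> X -> X) (N : set (borel X)),
    [/\ forall n, measurable_fun [set: borel X] (s n : borel X -> borel X),
        s 0%N = id, measurable N, eta N = 0 &
        forall x y (r : R), ~ N x -> r%:E < f (x, y) ->
          exists n, r%:E < f (x, s n x)].
Proof.
move=> mf; have [d [q [dm dtop dc dq]]] := polish_metric _ _ pol.
pose B (r : rat) : set (borel (pprod X X)) := [set p | (ratr r)%:E < f p].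
have mB r : measurable (B r).
  rewrite (_ : B r = [set: borel (pprod X X)] `&` [set p | (ratr r)%:E < f p]).
    by apply: emeasurable_fun_o_infty.
  by rewrite setTI.
have i0 (k : nat) : (0 < k.+1%:R^-1 :> R)%R by rewrite invr_gt0 ltr0n.
pose sel r k := measurable_selection d q dm dtop dq dc eta (B r) (k.+1%:R^-1)%R (mB r) (i0 k).
have /choice[A /choice[s /choice[H Hsel]]] := fun rk : rat * nat => sel rk.1 rk.2.
pose N := \bigcup_(r : rat) \bigcap_k H (r, k).
have mN r : measurable (\bigcap_k H (r, k) : set (borel X)).
  by apply: bigcapT_measurable => k; have [_ _ _ []] := Hsel (r, k).
exists (fun n => if n is n'.+1 then
    if (unpickle n' : option (rat * nat)) is Some rk then s rk else id else id), N.
split => //.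
- case=> [|n]; first exact: measurable_id.
  case: unpickle => [rk|]; last exact: measurable_id.
  by have [_ ? _ _] := Hsel rk.
- exact: bigcupT_measurable_rat.
- have nr r : eta (\bigcap_k H (r, k)) = 0.
    apply/eqP; rewrite -measure_le0; apply/lee_addgt0Pr => e /natSinv_lt[k ke].
    have [_ _ _ [mH Hk _]] := Hsel (r, k).
    rewrite add0e; apply: (@le_trans _ _ (eta (H (r, k)))).
      by apply: le_measure; rewrite ?inE// => x; apply.
    by apply: (le_trans Hk); rewrite lee_fin ltW.
  apply/negligibleP; first exact: bigcupT_measurable_rat.
  have -> : N = \bigcup_n (if (unpickle n : option rat) is Some r
      then \bigcap_k H (r, k) else set0).
    apply/seteqP; split => [x [r _ Hx]|x [n _]].
      by exists (pickle r); [exact: I|rewrite pickleK].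
    by case: unpickle => // r Hx; exists r.
  apply: negligible_bigcup => n; case: unpickle => [r|]; last exact: negligible_set0.
  by apply/negligibleP; [exact: mN|exact: nr].
move=> x y r nN rf.
(* A real [z] leaves room for a rational level above [r], also where [f (x, y)] is infinite. *)
have [z rz zf] : exists2 z : R, (r < z)%R & z%:E <= f (x, y).
  case: (f (x, y)) rf => [w| |//].
  - by rewrite lte_fin => rw; exists w.
  - by move=> _; exists (r + 1)%R; rewrite ?ltrDl// leey.
have [r' /itvP r'i] := rat_in_itvoo rz.
have rr' : (r < ratr r')%R by rewrite r'i.
have Bxy : B r' (x, y) by rewrite /B /= (lt_le_trans _ zf)// lte_fin r'i.
have [k nH] : exists k, ~ H (r', k) x.
  by apply/existsNP => Hx; apply: nN; exists r' => // k _.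
have [_ _ AB [_ _ AH]] := Hsel (r', k).
exists (pickle (r', k)).+1; rewrite pickleK.
have [Ax|//] := AH _ _ Bxy.
by apply: (lt_trans _ (AB _ Ax)); rewrite lte_fin.
Qed.

End selections.

(** The completion measures every subset of [N], so [g] is measurable for it, and the expectation
    reduces to a Borel integral. *)
Lemma Ecompl_ae_eq {R : realType} {X : ptopologicalType} (Q : prob X R)
    (N : set (borel X)) (g h : X -> \bar R) :
  measurable_fun [set: borel X] (h : borel X -> \bar R) ->
  measurable N -> Q N = 0 -> (forall x, ~ N x -> g x = h x) ->
  Ecompl Q g = \int[Q]_x h x.
Proof.
move=> mh mN QN gh.
pose I : measurableType _ := caratheodory_type (Q^*)%mu.
have mI (A : set (borel X)) : measurable A -> measurable (A : set I).
  move=> mA; apply: sub_caratheodory; exact: sub_sigma_algebra.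
pose cQ : {measure set I -> \bar R} := @completed_measure_extension _ _ _ Q.
have cQE (A : set (borel X)) : measurable A -> cQ A = Q A.
  by move=> mA; rewrite /cQ /= /completed_measure_extension measurable_mu_extE.
have mhI : measurable_fun [set: I] (h : I -> \bar R).
  by move=> _ Y mY; apply: mI; exact: mh.
rewrite (@integral_transfer _ I _ cQ _ (borel X) Q id h)//; last first.
- by move=> _ Y mY; rewrite setTI; exact: mI.
rewrite /Ecompl; apply: ae_eq_integral => //.
- move=> _ Y mY; rewrite setTI.
  rewrite (_ : g @^-1` Y = (h @^-1` Y `\` N) `|` (g @^-1` Y `&` N)).
    apply: measurableU.
      apply: mI; apply: measurableD => //.
      by rewrite -[X in measurable X]setTI; exact: mh.
    apply: measure_is_complete_caratheodory; exists N; split.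
    + exact: mI.
    + by rewrite -QN; exact: cQE.
    + by move=> x [].
  apply/seteqP; split => x /=.
    move=> Yx; have [Nx|nNx] := pselect (N x); [by right|left].
    by rewrite -gh.
  by move=> [[Yx nNx]|[]//]; rewrite gh.
- exists N; split; [exact: mI|by rewrite -QN; exact: cQE|].
  move=> x /= H; apply: contrapT => nN; apply: H => _; exact: gh.
Qed.

(** * The OT-regularized loss as a supremum over plans *)

Lemma mule_gain {R : realType} (l : R) (a b : \bar R) : (0 < l)%R -> a < +oo ->
  0 <= b -> l%:E * (l^-1%:E * a - b) = a - l%:E * b.
Proof.
move=> l0; have li : (0 < l^-1)%R by rewrite invr_gt0.
case: a => [a| |] // _; case: b => [b| |] // _.
- by rewrite -?(EFinM, EFinB) mulrBr mulrA divff ?mul1r ?gt_eqF.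
- by rewrite addeNy !gt0_muleNy ?lte_fin// gt0_muley ?lte_fin.
- by rewrite gt0_muleNy ?lte_fin// addNye gt0_muleNy ?lte_fin.
- by rewrite gt0_muleNy ?lte_fin// addNye gt0_muleNy ?lte_fin.
Qed.

Lemma le_gain {R : realType} (l : R) (u a b : \bar R) : (0 < l)%R -> a < +oo ->
  0 <= b -> u <= l^-1%:E * a - b -> l%:E * u + l%:E * b <= a.
Proof.
move=> l0 aoo b0; rewrite -(@lee_pmul2l _ l%:E) ?lte_fin// mule_gain//.
case: a aoo => [a| |] // _; case: b b0 => [b| |] // b0.
- by rewrite -EFinM leeBrDr.
- by rewrite gt0_muley ?lte_fin// addeNy leeNy_eq => /eqP ->; rewrite addNye leNye.
- by rewrite addNye leeNy_eq => /eqP ->; rewrite addNye leNye.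
- by rewrite gt0_muley ?lte_fin// addNye leeNy_eq => /eqP ->; rewrite addNye leNye.
Qed.

Section couplings.
Context {R : realType} {X : ptopologicalType}.

Lemma measurable_pprod_fst :
  measurable_fun [set: borel (pprod X X)] (fst : borel (pprod X X) -> borel X).
Proof.
apply: (@measurability _ _ (borel (pprod X X)) (borel X) setT _ (@open X)) => //.
move=> _ [U Uo <-]; rewrite setTI; apply: sub_sigma_algebra.
by apply: open_comp => // z _; exact: cvg_fst.
Qed.

Lemma measurable_pprod_snd :
  measurable_fun [set: borel (pprod X X)] (snd : borel (pprod X X) -> borel X).
Proof.
apply: (@measurability _ _ (borel (pprod X X)) (borel X) setT _ (@open X)) => //.
move=> _ [U Uo <-]; rewrite setTI; apply: sub_sigma_algebra.
by apply: open_comp => // z _; exact: cvg_snd.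
Qed.

Context (eta nu : prob X R) (pi : prob (pprod X X) R) (cpl : coupling eta nu pi).

Lemma coupling_fst (A : set (borel X)) : measurable A ->
  pi ((fst : borel (pprod X X) -> borel X) @^-1` A) = eta A.
Proof.
move=> /cpl[<- _]; congr (pi _).
by apply/seteqP; split => [z Az|z []] //; split.
Qed.

Lemma coupling_snd (A : set (borel X)) : measurable A ->
  pi ((snd : borel (pprod X X) -> borel X) @^-1` A) = nu A.
Proof.
move=> /cpl[_ <-]; congr (pi _).
by apply/seteqP; split => [z Az|z []] //; split.
Qed.

End couplings.

Section loss.
Context {R : realType} {X : ptopologicalType} (pol : polish R X).
Context (L : X -> \bar R) (c : pprod X X -> \bar R) (l : R).
Hypotheses (mL : measurable_fun [set: borel X] (L : borel X -> \bar R))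
  (Loo : forall x, L x < +oo)
  (mc : measurable_fun [set: borel (pprod X X)] (c : borel (pprod X X) -> \bar R))
  (c0 : forall p, 0 <= c p) (cxx : forall x : X, c (x, x) = 0) (l0 : (0 < l)%R).

Definition gain (p : pprod X X) : \bar R := l^-1%:E * L p.2 - c p.

Lemma measurable_gain :
  measurable_fun [set: borel (pprod X X)] (gain : borel (pprod X X) -> \bar R).
Proof.
apply: emeasurable_funB => //; apply: measurable_funeM.
exact: (measurableT_comp mL measurable_pprod_snd).
Qed.

Lemma gain_diag x : gain (x, x) = l^-1%:E * L x.
Proof. by rewrite /gain cxx sube0. Qed.

(** A Borel version [h] of the loss: a supremum of gains along countably many selections. Off the
    null set of [countable_selection] it dominates every gain, hence equals the loss. *)
Lemma loss_version (eta : prob X R) : exists (s : nat -> X -> X) (h : X -> \bar R),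
  [/\ forall n, measurable_fun [set: borel X] (s n : borel X -> borel X),
      s 0%N = id, measurable_fun [set: borel X] (h : borel X -> \bar R) &
  [/\ Ecompl eta (OTreg_loss L c l) = \int[eta]_x h x,
      forall x, ereal_sup (range (fun n => gain (x, s n x))) = h x &
      exists N : set (borel X), [/\ measurable N, eta N = 0 &
        forall x y, ~ N x -> gain (x, y) <= h x]]].
Proof.
have [s [N [ms s0 mN N0 HN]]] := countable_selection pol eta _ measurable_gain.
pose h x := ereal_sup (range (fun n => gain (x, s n x))).
have mh : measurable_fun [set: borel X] (h : borel X -> \bar R).
  have := @measurable_fun_esups _ (borel X) R setT (fun n x => gain (x, s n x)).
  move=> /(_ _ 0%N) H; apply: eq_measurable_fun (H _) => [x _|n].
    by rewrite /esups /h /sdrop /=; congr (ereal_sup (_ @` _)); apply/seteqP; split.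
  exact: (measurableT_comp measurable_gain (measurable_graph pol _ (ms n))).
have Ngain x y : ~ N x -> gain (x, y) <= h x.
  move=> Nx; rewrite leNgt; apply/negP => hg.
  have [r hr rg] : exists2 r : R, h x <= r%:E & r%:E < gain (x, y).
    case: (h x) hg => [r| |]; first by move=> rg; exists r.
      by rewrite ltNge leey.
    case: (gain (x, y)) => [r _| _|//].
      by exists (r - 1)%R; rewrite ?leNye// lte_fin ltrBlDr ltrDl.
    by exists 0%R; rewrite ?leNye ?ltry.
  have [n rn] := HN x y r Nx rg.
  have := le_lt_trans hr rn; rewrite ltNge => /negP; apply.
  by apply: ereal_sup_ubound; exists n.
exists s, h; split => //; split => //; last by exists N; split.
apply: (Ecompl_ae_eq eta N) => // x Nx; apply/eqP; rewrite eq_le; apply/andP; split.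
  by apply: ge_ereal_sup => _ [y _ <-]; exact: Ngain.
by apply: ge_ereal_sup => _ [n _ <-]; apply: ereal_sup_ubound; exists (s n x).
Qed.

Lemma coupling_le_loss (eta nu : prob X R) (pi : prob (pprod X X) R) :
  coupling eta nu pi -> \int[pi]_p c p < +oo ->
  \int[nu]_x L x - l%:E * \int[pi]_p c p <= l%:E * Ecompl eta (OTreg_loss L c l).
Proof.
move=> cpl cfin; have [s [h [ms s0 mh [-> hE [N [mN N0 Nh]]]]]] := loss_version eta.
have m2 := @measurable_pprod_snd X; have m1 := @measurable_pprod_fst X.
rewrite (integral_transfer _ _ _ _ _ _ m2 (coupling_snd _ _ _ cpl) mL).
rewrite (integral_transfer _ _ _ _ _ _ m1 (coupling_fst _ _ _ cpl) mh).
have mL2 := measurableT_comp mL m2; have mh1 := measurableT_comp mh m1.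
have lE : 0 <= l%:E by rewrite lee_fin ltW.
have <- : \int[pi]_p (l%:E * c p) = l%:E * \int[pi]_p c p by rewrite ge0_integralZl.
rewrite -integralZl_pos//.
apply: (le_trans (le_integralB _ _ _ mL2 _ _ _)).
- exact: measurable_funeM.
- by move=> x; rewrite mule_ge0.
- rewrite ge0_integralZl//; apply: lte_mul_pinfty => //.
apply: ae_le_integral.
- by apply: emeasurable_funB => //; exact: measurable_funeM.
- exact: measurable_funeM.
(* The inequality can fail only over [N]; that cylinder is [pi]-null because the first marginal of
   [pi] is [eta]. *)
exists (N `*` setT); split.
- by rewrite (_ : N `*` setT = fst @^-1` N);
     [rewrite -[X in measurable X]setTI; exact: m1|
      apply/seteqP; split => [z []|z Nz] //; split].
- by rewrite -N0; exact: (cpl N mN).1.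
move=> [x y] /= H; split => //=; apply: contrapT => nN; apply: H.
rewrite -mule_gain// lee_pmul2l ?lte_fin//.
exact: Nh nN.
Qed.

End loss.

(** * Bounding the expected loss by near-optimal plans *)

(** Testing against reals below [I] reduces a supremum that may be infinite or not attained to
    finite targets [b]. *)
Lemma lee_pmull_lt {R : realType} (l M : R) (I : \bar R) : (0 < l)%R ->
  (forall b : R, b%:E < I -> (l * b <= M)%R) -> l%:E * I <= M%:E.
Proof.
move=> l0; case: I => [r| |] H.
- rewrite -EFinM lee_fin; apply/ler_addgt0Pr => e e0.
  have := H (r - e / l)%R; rewrite lte_fin ltrBlDr ltrDl divr_gt0// => /(_ isT).
  by rewrite mulrBr mulrCA divff ?gt_eqF// mulr1 lerBlDr.
- have := H ((M + 1) / l)%R (ltry _).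
  by rewrite mulrCA divff ?gt_eqF// mulr1 gerDl ler10.
- by rewrite gt0_muleNy ?lte_fin// leNye.
Qed.

Import HBNNSimple.

Lemma nnsfun_lt_integral {d} {T : measurableType d} {R : realType}
    (mu : {measure set T -> \bar R}) (H : T -> \bar R) (a : R) :
  (forall x, 0 <= H x) -> a%:E < \int[mu]_x H x ->
  exists phi : {nnsfun T >-> R}, (forall x, (phi x)%:E <= H x) /\
    a%:E < \int[mu]_x (phi x)%:E.
Proof.
move=> H0; rewrite ge0_integralTE// => /ereal_sup_gt[_ [phi phiH <-] aphi].
by exists phi; split => //; rewrite integral_nnsfun// patch_setT.
Qed.

Lemma cvg_integral_patch {d} {T : measurableType d} {R : realType}
    (mu : {measure set T -> \bar R}) (E : nat -> set T) (f : T -> \bar R) :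
  (forall n, measurable (E n)) -> (forall m n, (m <= n)%N -> E m `<=` E n) ->
  (forall x, exists n, E n x) -> measurable_fun [set: T] f -> (forall x, 0 <= f x) ->
  \int[mu]_x (f \_ (E n)) x @[n --> \oo] --> \int[mu]_x f x.
Proof.
move=> mE ndE covE mf f0.
have lim_f x : (f \_ (E n)) x @[n --> \oo] --> f x.
  have [N ENx] := covE x; apply: cvg_near_cst; exists N => // n /= Nn.
  by rewrite patchE mem_set//; exact: ndE ENx.
rewrite (eq_integral (fun x => limn (fun n => (f \_ (E n)) x))); last first.
  by move=> x _; apply/esym/cvg_lim => //; exact: lim_f.
apply: cvg_monotone_convergence => //.
- by move=> n; apply/(measurable_restrictT _ _).1 => //; exact: measurable_funTS.
- by move=> n x _; rewrite patchE; case: ifPn.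
- move=> x _ m n mn; rewrite !patchE; case: ifPn => [/set_mem Em|_].
    by rewrite mem_set//; exact: ndE Em.
  by case: ifPn.
Qed.

Lemma lt_EFin_add {R : realType} (a : R) (I : \bar R) : a%:E < I ->
  exists2 e : R, (0 < e)%R & (a + e)%:E < I.
Proof.
case: I => [r| |//]; last by exists 1%R; rewrite ?ltr01// ltry.
rewrite lte_fin => ar; exists ((r - a) / 2)%R; first by rewrite divr_gt0 ?subr_gt0.
by rewrite lte_fin; lra.
Qed.

Lemma leeB_ge0 {R : realType} (x y : \bar R) : 0 <= y -> x - y <= x.
Proof. by move=> y0; rewrite -[leRHS]sube0 leeB. Qed.

(** With [a] a value of [L] and [b] a cost, a lower bound on the gain turns an upper bound on [L]
    into one on the cost; selections get finite cost this way. *)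
Lemma gain_cost_le {R : realType} (l M0 : R) (u a b : \bar R) : (0 < l)%R ->
  a <= M0%:E -> 0 <= b -> u <= l^-1%:E * a - b -> b <= (l^-1 * M0)%:E - u.
Proof.
move=> l0 aM b0.
have la : l^-1%:E * a <= (l^-1 * M0)%:E.
  by rewrite EFinM lee_pmul2l ?lte_fin ?invr_gt0.
case: u => [r| |] ur; last by rewrite addey// leey.
- have bfin : b \is a fin_num.
    rewrite ge0_fin_numE// ltey; apply/eqP => bE; move: ur.
    by rewrite bE addeNy leeNy_eq.
  by move: ur; rewrite leeBrDr// => /le_trans/(_ la); rewrite addeC leeBrDr.
- have : l^-1%:E * a - b <= (l^-1 * M0)%:E by rewrite (le_trans _ la)// leeB_ge0.
  by move=> /(le_trans ur); rewrite leye_eq.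
Qed.

Lemma probability_integral_cst {d} {T : measurableType d} {R : realType}
    (P : probability T R) (k : R) : \int[P]_x k%:E = k%:E.
Proof.
transitivity (k%:E * P [set: T]); last by rewrite probability_setT mule1.
exact: (integral_cst P measurableT k%:E).
Qed.

(** The plan moves each [x] to [sg x]: [nu] and [pi] are the laws under [eta] of [sg] and of its
    graph map. *)
Lemma graph_coupling {R : realType} {X : ptopologicalType} (pol : polish R X)
    (eta : prob X R) (sg : borel X -> borel X) :
  measurable_fun [set: borel X] sg ->
  exists (nu : prob X R) (pi : prob (pprod X X) R),
    [/\ coupling eta nu pi,
        forall A, measurable A -> nu A = eta (sg @^-1` A),
        forall F : pprod X X -> \bar R,
          measurable_fun [set: borel (pprod X X)] (F : borel (pprod X X) -> \bar R) ->
          \int[pi]_p F p = \int[eta]_x F (x, sg x) &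
        forall F : X -> \bar R,
          measurable_fun [set: borel X] (F : borel X -> \bar R) ->
          \int[nu]_x F x = \int[eta]_x F (sg x)].
Proof.
move=> msg; have mg := measurable_graph pol sg msg.
pose sg' : {mfun borel X >-> borel X} :=
  HB.pack sg (isMeasurableFun.Build _ _ _ _ _ msg).
pose gr : {mfun borel X >-> borel (pprod X X)} :=
  HB.pack (fun x => (x, sg x)) (isMeasurableFun.Build _ _ _ _ _ mg).
exists (distribution eta sg'), (distribution eta gr); split => //.
- move=> A mA; split.
    rewrite /= /distribution /pushforward; congr (eta _).
    by apply/seteqP; split => [x []//|x Ax]; split.
  rewrite /= /distribution /pushforward; congr (eta _).
  by apply/seteqP; split => [x []//|x Ax]; split.
- by move=> F mF; apply: (@integral_transfer _ _ _ eta _ _ _ gr).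
- by move=> F mF; apply: (@integral_transfer _ _ _ eta _ _ _ sg').
Qed.

Section dual_loss.
Context {R : realType} {X : ptopologicalType} (pol : polish R X).
Context (L : X -> \bar R) (c : pprod X X -> \bar R) (l : R).
Hypotheses (mL : measurable_fun [set: borel X] (L : borel X -> \bar R))
  (Loo : forall x, L x < +oo)
  (mc : measurable_fun [set: borel (pprod X X)] (c : borel (pprod X X) -> \bar R))
  (c0 : forall p, 0 <= c p) (cxx : forall x : X, c (x, x) = 0) (l0 : (0 < l)%R).
Context (eta : prob X R) (M : R).
Hypothesis bounded : forall (nu : prob X R) (pi : prob (pprod X X) R),
  coupling eta nu pi -> \int[pi]_p c p < +oo ->
  \int[nu]_x L x - l%:E * \int[pi]_p c p <= M%:E.

Let integrable_cst (k : R) : eta.-integrable [set: borel X] (EFin \o cst k).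
Proof. exact: finite_measure_integrable_cst. Qed.

(** The bound [M] is applied to the plan carried by the graph of [sg], after integrating l u(x) + l
    c(x, sg x) <= L(sg x). *)
Lemma plan_le_bound (sg : borel X -> borel X) (u : borel X -> \bar R) :
  measurable_fun [set: borel X] sg -> eta.-integrable [set: borel X] u ->
  \int[eta]_x c (x, sg x) < +oo -> (forall x, u x <= gain L c l (x, sg x)) ->
  l%:E * \int[eta]_x u x <= M%:E.
Proof.
move=> msg iu cfin ug.
have [nu [pi [cpl _ piE nuE]]] := graph_coupling pol eta sg msg.
have mg := measurable_graph pol sg msg.
have cE := piE c mc; have LE := nuE L mL.
have := bounded nu pi cpl; rewrite cE LE => /(_ cfin); apply: le_trans.
have mcs : measurable_fun [set: borel X] (fun x => c (x, sg x)).
  exact: (measurableT_comp mc mg).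
have ic : eta.-integrable [set: borel X] (fun x => c (x, sg x)).
  apply/integrableP; split => //.
  by under eq_integral do rewrite gee0_abs//.
have cfn : \int[eta]_x c (x, sg x) \is a fin_num.
  by rewrite ge0_fin_numE// integral_ge0.
rewrite leeBrDr ?fin_numM// -!integralZl// -integralD//; try exact: integrableZl.
apply: le_integral_measurable.
- by apply: emeasurable_funD; apply: measurable_funeM => //; exact: measurable_int iu.
- exact: measurableT_comp mL msg.
- by move=> x; exact: le_gain (ug x).
Qed.

(** Here [h] is bounded above, and an integral above [b] makes it integrable. Lowering it by a
    constant gives [u] of integral exactly [b], which some selection reaches; the cost is then at
    most an integrable function of [u]. *)
Lemma loss_le_bound_above (M0 : R) : (forall x, L x <= M0%:E) ->
  l%:E * Ecompl eta (OTreg_loss L c l) <= M%:E.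
Proof.
move=> LM; have [s [h [ms s0 mh [-> hE _]]]] := loss_version pol L c l mL mc eta.
apply: lee_pmull_lt => // b bh.
have gM p : gain L c l p <= (l^-1 * M0)%:E.
  rewrite /gain; apply: (@le_trans _ _ (l^-1%:E * L p.2)).
    by rewrite leeB_ge0.
  by rewrite EFinM lee_pmul2l ?lte_fin ?invr_gt0.
have hM x : h x <= (l^-1 * M0)%:E.
  by rewrite -hE; apply: ge_ereal_sup => _ [n _ <-].
have ih : eta.-integrable [set: borel X] h.
  apply: integrable_posneg => //.
    apply: (@le_lt_trans _ _ (\int[eta]_x (`|l^-1 * M0|%R)%:E)).
      apply: ge0_le_integral => //.
        exact: measurable_funepos.
      move=> x _; rewrite funeposE ge_max lee_fin normr_ge0 andbT.
      by apply: (le_trans (hM x)); rewrite lee_fin ler_norm.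
    rewrite probability_integral_cst; exact: ltry.
  rewrite ltey; apply/eqP => hn; move: bh.
  by rewrite integralE hn addeNy ltNge leNye.
have hfin : \int[eta]_x h x \is a fin_num by exact: integrable_fin_num.
pose I := fine (\int[eta]_x h x).
have IE : \int[eta]_x h x = I%:E by rewrite fineK.
have e0 : (0 < I - b)%R by rewrite subr_gt0 -lte_fin -IE.
pose u x := h x - (I - b)%:E.
have iu : eta.-integrable [set: borel X] u.
  exact: (integrableB measurableT ih (integrable_cst (I - b)%R)).
have uI : \int[eta]_x u x = b%:E.
  rewrite (integralB measurableT ih (integrable_cst (I - b)%R)) IE (probability_integral_cst eta).
  by rewrite -EFinB opprB addrC subrK.
have mu : measurable_fun [set: borel X] u by exact: measurable_int iu.
have mgs n : measurable_fun [set: borel X] (fun x => gain L c l (x, s n x)).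
  exact: (measurableT_comp (measurable_gain L c l mL mc) (measurable_graph pol _ (ms n))).
have [n|x|sg msg Hsg] := @measurable_fun_first _ _ (borel X) (borel X)
    (fun n => [set x | u x <= gain L c l (x, s n x)]) s _ ms.
- by rewrite -[X in measurable X]setTI; exact: measurable_lee.
(* If no selection reached [u x], then [h x <= u x], impossible for real [h x]; where [h x] is
   [-oo], so is [u x], and index 0 works. *)
- apply: contrapT => /forallNP H.
  have gu n : gain L c l (x, s n x) <= u x by apply/ltW; rewrite ltNge; apply/negP/H.
  have hu : h x <= u x by rewrite -hE; apply: ge_ereal_sup => _ [n _ <-].
  apply: (H 0%N) => /=; move: hu; rewrite /u; move: (hM x).
  case: (h x) => [r| |] // _.
    by rewrite -EFinB lee_fin lerDl oppr_ge0 leNgt e0.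
  by rewrite addNye !leNye.
have ug x : u x <= gain L c l (x, sg x) by have [n /= ? ->] := Hsg x.
rewrite -lee_fin EFinM -uI; apply: (plan_le_bound sg u msg iu _ ug).
have iK : eta.-integrable [set: borel X] (fun x => (l^-1 * M0)%:E - u x).
  exact: (integrableB measurableT (integrable_cst (l^-1 * M0)%R) iu).
apply: (le_lt_trans _ (integrable_lty measurableT iK)).
apply: ge0_le_integral => //.
- exact: (measurableT_comp mc (measurable_graph pol _ msg)).
- exact: measurable_int iK.
by move=> x _; apply: gain_cost_le (ug x).
Qed.

(* When [L] is only bounded below, the cost of a near-optimal selection may have
   infinite integral; replacing the selection by the identity where [L (sg x) > n]
   bounds the cost and loses little as [n] grows. *)
Lemma loss_le_bound_below (m : R) : (forall x, m%:E <= L x) ->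
  l%:E * Ecompl eta (OTreg_loss L c l) <= M%:E.
Proof.
move=> Lm; have [s [h [ms s0 mh [-> hE _]]]] := loss_version pol L c l mL mc eta.
apply: lee_pmull_lt => // b bh.
pose k := (l^-1 * m)%R.
have kL x : k%:E <= l^-1%:E * L x.
  by rewrite EFinM lee_pmul2l ?lte_fin ?invr_gt0.
have kh x : k%:E <= h x.
  apply: (le_trans (kL x)); rewrite -hE; apply: ereal_sup_ubound; exists 0%N => //.
  by rewrite s0 gain_diag.
(* Staying in place gains at least [k], so [H] is nonnegative and a simple function below it
   approximates its integral. *)
pose H x := h x - k%:E.
have H0 x : 0 <= H x by rewrite /H sube_ge0.
have mH : measurable_fun [set: borel X] H by exact: emeasurable_funB.
have bH : (b - k)%:E < \int[eta]_x H x.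
  have [->|HN] := eqVneq (\int[eta]_x H x) +oo; first exact: ltry.
  have iH : eta.-integrable [set: borel X] H.
    apply/integrableP; split => //.
    by under eq_integral do rewrite gee0_abs//; rewrite ltey.
  rewrite EFinB lteBlDr//; apply: (lt_le_trans bh).
  have -> : \int[eta]_x h x = \int[eta]_x (H x + k%:E).
    by apply: eq_integral => x _; rewrite /H subeK.
  rewrite (integralD measurableT iH (integrable_cst k)) (probability_integral_cst eta).
  exact: lexx.
have [e e0 beH] := lt_EFin_add _ _ bH.
have [phi [phiH bphi]] := nnsfun_lt_integral eta H _ H0 beH.
(* Real-valued and, thanks to [e], strictly below [h], so some selection reaches [u] even where [h]
   is infinite. *)
pose u (x : borel X) := (phi x - e + k)%:E.
have mphi : measurable_fun [set: borel X] (EFin \o phi) by exact/measurable_EFinP.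
have mu : measurable_fun [set: borel X] u.
  apply/measurable_EFinP; apply: measurable_funD => //.
  by apply: measurable_funB => //.
have mgs n : measurable_fun [set: borel X] (fun x => gain L c l (x, s n x)).
  exact: (measurableT_comp (measurable_gain L c l mL mc) (measurable_graph pol _ (ms n))).
have [n|x|sg msg Hsg] := @measurable_fun_first _ _ (borel X) (borel X)
    (fun n => [set x | u x <= gain L c l (x, s n x)]) s _ ms.
- by rewrite -[X in measurable X]setTI; exact: measurable_lee.
- apply: contrapT => /forallNP nH.
  have : h x <= u x.
    rewrite -hE; apply: ge_ereal_sup => _ [n _ <-].
    by apply/ltW; rewrite ltNge; apply/negP/nH.
  move: (phiH x); rewrite /H /u; move: (kh x); case: (h x) => [r| |] // _.
  by rewrite -EFinB !lee_fin; lra.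
have ug x : u x <= gain L c l (x, sg x) by have [n /= ? ->] := Hsg x.
have mLsg := measurableT_comp mL msg.
pose E n : set (borel X) := [set x | L (sg x) <= n%:R%:E].
have mE n : measurable (E n).
  rewrite -[E n]setTI; apply: measurable_lee => //.
have ndE p q : (p <= q)%N -> E p `<=` E q.
  by move=> pq x /le_trans; apply; rewrite lee_fin ler_nat.
have covE x : exists n, E n x.
  rewrite /E /=; move: (Loo (sg x)); case: (L (sg x)) => [r _| //|_].
    exists (Num.bound `|r|%R); rewrite lee_fin; apply: ltW.
    by apply: (le_lt_trans (ler_norm _)); exact: archi_boundP.
  by exists 0%N; rewrite leNye.
have phi0 x : 0 <= (phi x)%:E by rewrite lee_fin.
have [n bn] : exists n, (b - k + e)%:E < \int[eta]_x ((EFin \o phi) \_ (E n)) x.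
  apply: contrapT => /forallNP nH; move: bphi; apply/negP; rewrite -leNgt.
  apply: cvge_le (cvg_integral_patch eta E (EFin \o phi) mE ndE covE mphi phi0).
  by apply: nearW => n; rewrite leNgt; apply/negP/nH.
have [i|i|x|sg' msg' Hsg'] := @measurable_fun_first _ _ (borel X) (borel X)
    (fun i => if i is 0%N then E n else ~` E n)
    (fun i => if i is 0%N then sg else id).
- by case: i => // _; exact: measurableC.
- by case: i => // _; exact: measurable_id.
- by have [Ex|nEx] := pselect (E n x); [exists 0%N|exists 1%N].
have {}Hsg' x : sg' x = if x \in E n then sg x else x.
  have [[Ex ->|i nEx ->]] := Hsg' x; first by rewrite mem_set.
  by rewrite memNset.
(* On [E n] this is [u]; elsewhere it is [k - e], below the gain of staying in place. *)
pose u' x := ((EFin \o phi) \_ (E n)) x - (e - k)%:E.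
have iphi : eta.-integrable [set: borel X] ((EFin \o phi) \_ (E n)).
  rewrite (_ : _ \_ _ = EFin \o (fun x => phi x * \1_(E n) x)%R); last first.
    apply/funext => x; rewrite patchE /= indicE.
    by case: (x \in E n); rewrite ?mulr1 ?mulr0.
  apply: measurable_bounded_integrable => //.
  - by rewrite (le_lt_trans (probability_le1 _ _))// ltry.
  - by apply: measurable_funM => //; exact: measurable_indic.
  have [B [Br HB]] := simple_bounded phi.
  exists B; split => // z Bz x _ /=; apply: le_trans (HB z Bz x I).
  rewrite normrM ler_piMr// indicE ger0_norm//.
  by case: (x \in E n).
have iu' : eta.-integrable [set: borel X] u'.
  exact: (integrableB measurableT iphi (integrable_cst (e - k)%R)).
have u'I : b%:E <= \int[eta]_x u' x.
  rewrite (integralB measurableT iphi (integrable_cst (e - k)%R)) (probability_integral_cst eta).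
  rewrite leeBrDr//; apply: ltW; apply: le_lt_trans bn.
  by rewrite -EFinD lee_fin; lra.
have u'e x : (k - e)%:E <= u' x.
  rewrite /u' leeBrDr// -EFinD addrA subrK subrr patchE; case: ifPn => // _.
  exact: phi0.
have u'g x : u' x <= gain L c l (x, sg' x).
  rewrite Hsg' /u' patchE; case: ifPn => [_|_].
    by apply: le_trans (ug x); rewrite /u /= -EFinB lee_fin; lra.
  by rewrite gain_diag// sub0e; apply: le_trans (kL x); rewrite -EFinN lee_fin; lra.
rewrite -lee_fin EFinM; apply: (@le_trans _ _ (l%:E * \int[eta]_x u' x)).
  by rewrite lee_pmul2l ?lte_fin.
apply: (plan_le_bound sg' u' msg' iu' _ u'g).
(* On [E n], [L] is at most [n] after the move and the gain at least [k - e], which bounds the cost;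
   off [E n] nothing moves and the cost is 0. *)
pose C := (`|l^-1 * n%:R - (k - e)|)%R.
apply: (@le_lt_trans _ _ (\int[eta]_x C%:E)); last first.
  by rewrite probability_integral_cst; exact: ltry.
apply: ge0_le_integral => //.
- exact: (measurableT_comp mc (measurable_graph pol _ msg')).
move=> x _; have [/set_mem Ex|Ex] := boolP (x \in E n); last first.
  by rewrite Hsg' (negbTE Ex) cxx lee_fin normr_ge0.
have Lx : L (sg' x) <= n%:R%:E by rewrite Hsg' mem_set.
apply: (le_trans (gain_cost_le _ _ _ _ _ l0 Lx (c0 _) (u'g x))).
apply: (@le_trans _ _ ((l^-1 * n%:R)%:E - (k - e)%:E)); first exact: leeB.
by rewrite -EFinB lee_fin ler_norm.
Qed.

End dual_loss.

(** * Lagrangian duality *)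

Section mixture.
Context {d : measure_display} {T : measurableType d} {R : realType}.
Context (P1 P2 : probability T R) (t : R) (t01 : (0 <= t <= 1)%R).

Let t0 : (0 <= t)%R. Proof. by case/andP: t01. Qed.

Let t1 : (0 <= 1 - t)%R. Proof. by rewrite subr_ge0; case/andP: t01. Qed.

Definition mixture : set T -> \bar R :=
  measure_add (mscale (NngNum t0) P1) (mscale (NngNum t1) P2).

HB.instance Definition _ := Measure.on mixture.

Lemma mixtureE A : mixture A = t%:E * P1 A + (1 - t)%:E * P2 A.
Proof. by rewrite /mixture measure_addE. Qed.

Let mixture_setT : mixture [set: T] = 1.
Proof.
transitivity (t%:E * 1 + (1 - t)%:E * 1); last first.
  by rewrite !mule1 -EFinD addrC subrK.
by rewrite mixtureE; congr (_ * _ + _ * _); exact: probability_setT.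
Qed.

HB.instance Definition _ := Measure_isProbability.Build _ _ _ mixture mixture_setT.

Lemma ge0_integral_mixture (f : T -> \bar R) :
  measurable_fun [set: T] f -> (forall x, 0 <= f x) ->
  \int[mixture]_x f x = t%:E * \int[P1]_x f x + (1 - t)%:E * \int[P2]_x f x.
Proof.
by move=> mf f0; rewrite [LHS]ge0_integral_measure_add// !ge0_integral_mscale.
Qed.

(** Real lower bounds force the negative parts to have finite integrals, so no difference of
    infinities arises when the two measures are combined. *)
Lemma le_integral_mixture (r1 r2 : R) (f : T -> \bar R) : measurable_fun [set: T] f ->
  r1%:E <= \int[P1]_x f x -> r2%:E <= \int[P2]_x f x ->
  (t * r1 + (1 - t) * r2)%:E <= \int[mixture]_x f x.
Proof.
move=> mf; rewrite (integralE P1) (integralE P2) (integralE mixture).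
rewrite !ge0_integral_mixture//; try exact: measurable_funepos; try exact: measurable_funeneg.
have fin (r : R) (p n : \bar R) : 0 <= n -> r%:E <= p - n ->
    exists2 n' : R, n = n'%:E & (r + n')%:E <= p.
  case: n => [n| |] // n0; last by rewrite addeNy leeNy_eq.
  by rewrite leeBrDr//; exists n.
have key (p1 n1 p2 n2 : \bar R) : 0 <= n1 -> 0 <= n2 ->
    r1%:E <= p1 - n1 -> r2%:E <= p2 - n2 -> (t * r1 + (1 - t) * r2)%:E <=
      t%:E * p1 + (1 - t)%:E * p2 - (t%:E * n1 + (1 - t)%:E * n2).
  move=> n10 n20 /(fin _ _ _ n10)[m1 -> h1] /(fin _ _ _ n20)[m2 -> h2].
  rewrite -!EFinM -EFinD leeBrDr//.
  apply: (@le_trans _ _ (t%:E * (r1 + m1)%:E + (1 - t)%:E * (r2 + m2)%:E)).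
    by rewrite -!EFinM -!EFinD lee_fin; lra.
  by apply: leeD; apply: lee_wpmul2l; rewrite ?lee_fin.
by apply: key; exact: integral_ge0.
Qed.

End mixture.

Lemma lagrange_multiplier {R : realType} (A : R -> R -> Prop) (eps v b0 : R) :
  (0 < eps)%R ->
  (forall a1 b1 a2 b2 t, (0 <= t <= 1)%R -> A a1 b1 -> A a2 b2 ->
     A (t * a1 + (1 - t) * a2)%R (t * b1 + (1 - t) * b2)%R) ->
  A 0%R b0 -> (forall a b, A a b -> (a <= eps)%R -> (b <= v)%R) ->
  exists2 lam : R, (0 <= lam)%R & forall a b, A a b -> (b + lam * (eps - a) <= v)%R.
Proof.
move=> eps0 cvx A0 Av.
(* The multiplier is the largest slope, seen from the point [(eps, v)], of a point
   of [A] beyond [eps]; convexity bounds these slopes by those before [eps]. *)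
pose S := [set s : R | s = 0%R \/ exists a b, [/\ A a b, (eps < a)%R &
  s = ((b - v) / (a - eps))%R]].
have Sub a b : A a b -> (a < eps)%R -> ubound S ((v - b) / (eps - a))%R.
  move=> Aab aeps s; have ea : (0 < eps - a)%R by rewrite subr_gt0.
  have bv : (b <= v)%R by apply: (Av a) => //; exact: ltW.
  move=> [->|[a1 [b1 [A1 ea1 ->]]]]; first by rewrite divr_ge0 ?subr_ge0// ltW.
  have ea1' : (0 < a1 - eps)%R by rewrite subr_gt0.
  rewrite ler_pdivrMr// mulrAC ler_pdivlMr//.
  (* The weight for which the combination of [a1] and [a] is exactly [eps], where the chord lies at
     or below [v]. *)
  pose t := ((eps - a) / (a1 - a))%R.
  have a1a : (0 < a1 - a)%R by lra.
  have t01 : (0 <= t <= 1)%R.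
    apply/andP; split; first by rewrite divr_ge0// ltW.
    by rewrite ler_pdivrMr// mul1r; lra.
  have tE : (t * (a1 - a) = eps - a)%R by rewrite /t mulrVK// unitfE gt_eqF.
  have := Av _ _ (cvx _ _ _ _ t t01 A1 Aab).
  have -> : (t * a1 + (1 - t) * a = eps)%R.
    by rewrite mulrBl mul1r addrCA -mulrBr tE addrC subrK.
  move=> /(_ (lexx _)) => H.
  have : ((t * b1 + (1 - t) * b) * (a1 - a) <= v * (a1 - a))%R by rewrite ler_pM2r.
  have -> : ((t * b1 + (1 - t) * b) * (a1 - a) =
    (t * (a1 - a)) * b1 + ((a1 - a) - t * (a1 - a)) * b)%R by lra.
  by rewrite tE; lra.
have S0 : S !=set0 by exists 0%R; left.
(* The Slater point, at 0 < [eps], bounds the slopes. *)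
have hS : has_sup S by split => //; eexists; exact: Sub A0 eps0.
have lam0 : (0 <= sup S)%R by apply: ub_le_sup; [exact: hS.2|left].
exists (sup S) => // a b Aab; have [ae|ea|ae] := ltgtP a eps.
- have ea : (0 < eps - a)%R by rewrite subr_gt0.
  have := ge_sup S0 (Sub _ _ Aab ae); rewrite ler_pdivlMr//; lra.
- have ae : (0 < a - eps)%R by rewrite subr_gt0.
  have : ((b - v) / (a - eps) <= sup S)%R.
    by apply: ub_le_sup; [exact: hS.2|right; exists a, b].
  by rewrite ler_pdivrMr//; lra.
- by rewrite ae subrr mulr0 addr0; apply: (Av a) => //; rewrite ae.
Qed.

Section duality.
Context {R : realType} {X : ptopologicalType} (P : prob X R).
Context (L : X -> \bar R) (D : prob X R -> prob X R -> \bar R) (c : pprod X X -> \bar R).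
Hypotheses (pol : polish R X)
  (mL : measurable_fun [set: borel X] (L : borel X -> \bar R))
  (Loo : forall x, L x < +oo)
  (D0 : forall mu nu, 0 <= D nu mu) (DP : forall mu, D mu mu = 0)
  (Dcvx : convex_in_first D P)
  (mc : measurable_fun [set: borel (pprod X X)] (c : borel (pprod X X) -> \bar R))
  (c0 : forall p, 0 <= c p) (cxx : forall x : X, c (x, x) = 0).

(** The inequalities keep the set in the real plane and convex, although costs and values may be
    infinite. *)
Definition attainable (a b : R) : Prop :=
  exists (eta nu : prob X R) (pi : prob (pprod X X) R),
    [/\ coupling eta nu pi, D eta P + \int[pi]_p c p <= a%:E &
        b%:E <= \int[nu]_x L x].

Let int_c_ge0 (pi : prob (pprod X X) R) : 0 <= \int[pi]_p c p.
Proof. exact: integral_ge0. Qed.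

Lemma attainable_convex a1 b1 a2 b2 (t : R) : (0 <= t <= 1)%R ->
  attainable a1 b1 -> attainable a2 b2 ->
  attainable (t * a1 + (1 - t) * a2)%R (t * b1 + (1 - t) * b2)%R.
Proof.
move=> t01 [e1 [n1 [p1 [cp1 da1 b1L]]]] [e2 [n2 [p2 [cp2 da2 b2L]]]].
have /andP[t0 t1] := t01.
have tE : 0 <= t%:E by rewrite lee_fin.
have tE' : 0 <= (1 - t)%:E by rewrite lee_fin subr_ge0.
exists (mixture e1 e2 t t01), (mixture n1 n2 t t01), (mixture p1 p2 t t01); split.
- move=> A mA; have [h1 h2] := cp1 A mA; have [h3 h4] := cp2 A mA.
  by split; rewrite /= !mixtureE ?h1 ?h2 ?h3 ?h4.
- rewrite ge0_integral_mixture//.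
  apply: (@le_trans _ _ (t%:E * (D e1 P + \int[p1]_p c p) +
      (1 - t)%:E * (D e2 P + \int[p2]_p c p))).
    rewrite (ge0_muleDr _ (D0 P e1) (int_c_ge0 p1)).
    rewrite (ge0_muleDr _ (D0 P e2) (int_c_ge0 p2)) addeACA; apply: leeD => //.
    by apply: Dcvx => // A _; exact: mixtureE.
  by rewrite [leRHS]EFinD !EFinM; apply: leeD; exact: lee_wpmul2l.
- exact: le_integral_mixture.
Qed.

Lemma attainable_diag b : b%:E <= \int[P]_x L x -> attainable 0 b.
Proof.
move=> bL; have [nu [pi [cpl nuE piE _]]] := graph_coupling pol P id (@measurable_id _ _ _).
exists P, P, pi; split => //.
  by move=> A mA; have [-> ->] := cpl A mA; rewrite nuE.
rewrite DP add0e piE// (eq_integral (cst 0)) ?integral0// => x _.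
exact: cxx.
Qed.

Lemma OTreg_div_ge0 Q : 0 <= OTreg_div D c Q P.
Proof.
apply: le_ereal_inf_tmp => _ [eta _ <-]; apply: adde_ge0 => //.
by apply: le_ereal_inf_tmp => _ [pi _ <-].
Qed.

Lemma OTreg_div_le eta nu pi : coupling eta nu pi ->
  OTreg_div D c nu P <= D eta P + \int[pi]_p c p.
Proof.
move=> cpl; apply: (@le_trans _ _ (D eta P + OTcost c eta nu)).
  by apply: ereal_inf_lbound; exists eta.
by apply: leeD => //; apply: ereal_inf_lbound; exists pi.
Qed.

Lemma OTreg_div_lt Q (r : R) : OTreg_div D c Q P < r%:E ->
  exists (eta : prob X R) (pi : prob (pprod X X) R) (w z : R),
    [/\ coupling eta Q pi, D eta P = w%:E, \int[pi]_p c p = z%:E & (w + z < r)%R].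
Proof.
move=> /ereal_inf_lt[_ [eta _ <-]].
have := D0 P eta; case DE: (D eta P) => [w| |] // _; last first.
  have : OTcost c eta Q != -oo.
    rewrite -ltNye (lt_le_trans ltNy0)//.
    by apply: le_ereal_inf_tmp => _ [pi _ <-].
  by move=> /addye ->.
rewrite -lteBrDl// => /ereal_inf_lt[_ [pi cpl <-]].
have := int_c_ge0 pi; case pE: (\int[pi]_p c p) => [z| |] // _.
by rewrite lteBrDl// -EFinD lte_fin => wz; exists eta, pi, w, z; split.
Qed.

Lemma weak_duality (l r : R) (Q : prob X R) : (0 < l)%R -> OTreg_div D c Q P = r%:E ->
  \int[Q]_x L x <= (l * r)%:E +
    l%:E * ereal_sup [set Ecompl eta (OTreg_loss L c l) - D eta P
                     | eta in [set eta : prob X R | D eta P < +oo]].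
Proof.
move=> l0 Dr; set S := ereal_sup _; apply/lee_addgt0Pr => e e0.
(* The cost is multiplied by [l] below, so a plan within [e / l] of the infimum loses at most
   [e]. *)
have [|eta [pi [w [z [cpl Dw cz wz]]]]] := OTreg_div_lt Q (r + e / l).
  by rewrite Dr lte_fin ltrDl divr_gt0.
have := coupling_le_loss pol L c l mL Loo mc c0 l0 eta Q pi cpl.
rewrite cz => /(_ (ltry _)); rewrite -EFinM leeBlDr// => /le_trans; apply.
have SE : l%:E * Ecompl eta (OTreg_loss L c l) <= l%:E * S + (l * w)%:E.
  rewrite -leeBlDr// EFinM -muleBr//; last exact: fin_num_adde_defl.
  rewrite lee_pmul2l ?lte_fin//; apply: ereal_sup_ubound; exists eta; last by rewrite Dw.
  by rewrite /= Dw ltry.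
apply: (le_trans (leeD2r _ SE)).
rewrite (addeC (l * r)%:E) -!addeA; apply: leeD => //; rewrite -!EFinD lee_fin.
have : (l * (w + z) <= l * (r + e / l))%R by rewrite ler_pM2l// ltW.
by rewrite [X in (_ <= X)%R]mulrDr (mulrCA l e) divff ?gt_eqF// mulr1 mulrDr; lra.
Qed.

Hypothesis Lbound : (exists m : R, forall x, m%:E <= L x) \/
  ((exists M : R, forall x, L x <= M%:E) /\ P.-integrable [set: borel X] L^\-).

Lemma loss_le (l M : R) (eta : prob X R) : (0 < l)%R ->
  (forall (nu : prob X R) (pi : prob (pprod X X) R),
    coupling eta nu pi -> \int[pi]_p c p < +oo ->
    \int[nu]_x L x - l%:E * \int[pi]_p c p <= M%:E) ->
  l%:E * Ecompl eta (OTreg_loss L c l) <= M%:E.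
Proof.
move=> l0 H; case: Lbound => [[m Lm]|[[M0 LM] _]].
  exact: (loss_le_bound_below pol L c l mL Loo mc c0 cxx l0 eta M H m).
exact: (loss_le_bound_above pol L c l mL Loo mc c0 l0 eta M H M0).
Qed.

Lemma integral_P_gtNy : -oo < \int[P]_x L x.
Proof.
case: Lbound => [[m Lm]|[_ iL]].
  apply: (@lt_le_trans _ _ m%:E); first exact: ltNyr.
  rewrite -(probability_integral_cst P m); apply: le_integral_measurable => //.
rewrite integralE; have := integrable_lty measurableT iL.
have := @integral_ge0 _ _ _ P [set: borel X] L^\+ (fun x _ => funepos_ge0 L x).
have := @integral_ge0 _ _ _ P [set: borel X] L^\- (fun x _ => funeneg_ge0 L x).
case: (integral P _ L^\-) => [a| |] //; case: (integral P _ L^\+) => [b| |] // _ _ _.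
exact: ltNyr.
Qed.

(** The multiplier may be 0 while the dual ranges over positive [lambda]; hence the bound is given
    for every positive [l] from [lam + kappa] on. *)
Lemma strong_duality (eps kappa v : R) : (0 < eps)%R -> (0 <= kappa)%R ->
  (forall a b, attainable a b -> (a <= eps)%R -> (b - kappa * a <= v)%R) ->
  exists2 lam : R, (0 <= lam)%R & forall l : R, (0 < l)%R -> (lam + kappa <= l)%R ->
    l%:E * ereal_sup [set Ecompl eta (OTreg_loss L c l) - D eta P
                     | eta in [set eta : prob X R | D eta P < +oo]]
    <= (v - lam * eps)%:E.
Proof.
move=> eps0 kappa0 Hv.
have [b0 b0L] : exists b : R, b%:E <= \int[P]_x L x.
  move: integral_P_gtNy; case: (\int[P]_x L x) => [b| |] // _; first by exists b.
  by exists 0%R; exact: leey.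
(* Pairs of cost and penalized value; the penalty is linear in the cost, so convexity is
   preserved. *)
pose A a b := attainable a (b + kappa * a)%R.
have [||a b Aab ae|lam lam0 Hlam] := @lagrange_multiplier R A eps v b0 eps0.
- move=> a1 b1 a2 b2 t t01 A1 A2; have := attainable_convex _ _ _ _ _ t01 A1 A2.
  by rewrite /A; congr attainable; lra.
- by rewrite /A mulr0 addr0; exact: attainable_diag.
- by have := Hv _ _ Aab ae; lra.
exists lam => // l l0 laml; set S := ereal_sup _.
suff : S <= ((v - lam * eps) / l)%:E.
  move=> SE; apply: (@le_trans _ _ (l%:E * ((v - lam * eps) / l)%:E)).
    by rewrite lee_pmul2l ?lte_fin.
  by rewrite -EFinM mulrCA divff ?gt_eqF// mulr1.
apply: ge_ereal_sup => _ [eta Deta <-].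
have := D0 P eta; move: Deta => /=.
case Dw: (D eta P) => [w| |] // _; rewrite lee_fin => w0.
rewrite leeBlDr// -(@lee_pmul2l _ l%:E) ?lte_fin// -EFinD -EFinM.
rewrite mulrDr (mulrCA l) divff ?gt_eqF// mulr1.
apply: loss_le => // nu pi cpl.
have := int_c_ge0 pi; case cz: (\int[pi]_p c p) => [z| |] //.
rewrite lee_fin => z0 _; rewrite -EFinM leeBlDr// -[leLHS]mul1e -EFinD.
apply: lee_pmull_lt => // b bL; rewrite mul1r.
have : A (w + z)%R (b - kappa * (w + z))%R.
  by exists eta, nu, pi; split => //; rewrite ?Dw ?cz// subrK ltW.
move=> /Hlam.
(* Costs are nonnegative, so a larger [l] only lowers the value minus [l] times the cost. *)
have : ((lam + kappa) * (w + z) <= l * (w + z))%R by rewrite ler_wpM2r// addr_ge0.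
by lra.
Qed.

End duality.

Theorem theorem7 (R : realType) (X : ptopologicalType) (P : prob X R)
    (L : X -> \bar R) (D : prob X R -> prob X R -> \bar R)
    (c : pprod X X -> \bar R) :
  polish R X ->
  measurable_fun [set: borel X] L ->
  (forall x, L x < +oo) ->
  ((exists m : R, forall x, m%:E <= L x) \/
   ((exists M : R, forall x, L x <= M%:E) /\
    P.-integrable [set: borel X] (L^\-))) ->
  pre_divergence D ->
  convex_in_first D P ->
  cost_function c ->
  (forall x : X, c (x, x) = 0) ->
  forall eps kappa : R, (0 < eps)%R -> (0 <= kappa)%R ->
    ereal_sup [set (\int[Q]_x L x) - kappa%:E * OTreg_div D c Q P
               | Q in [set Q : prob X R | OTreg_div D c Q P <= eps%:E]]
    =
    ereal_inf [set lambda%:E * eps%:E +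
                   (lambda + kappa)%:E *
                   ereal_sup [set Ecompl Q (OTreg_loss L c (lambda + kappa)) - D Q P
                             | Q in [set Q : prob X R | D Q P < +oo]]
               | lambda in [set lambda : R | (0 < lambda)%R]].
Proof.
move=> pol mL Loo Lb [D0 [DP _]] Dcvx [/lsc_measurable mc c0] cxx eps kappa eps0 kappa0.
set primal := ereal_sup _; apply/eqP; rewrite eq_le; apply/andP; split.
  apply: le_ereal_inf_tmp => _ [lam /= lam0 <-]; apply: ge_ereal_sup => _ [Q /= Dle <-].
  (* Weak duality at [lam + kappa]: subtracting [kappa * r] leaves [lam * r], at most
     [lam * eps]. *)
  have l0 : (0 < lam + kappa)%R by rewrite ltr_wpDr.
  have := OTreg_div_ge0 P D c D0 c0 Q.
  case Dr: (OTreg_div D c Q P) Dle => [r| |] //; rewrite !lee_fin => reps r0.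
  have := weak_duality P L D c pol mL Loo D0 mc c0 _ _ Q l0 Dr.
  move=> /(leeD2r (- (kappa * r)%:E))/le_trans; apply.
  rewrite addeAC; apply: leeD => //; rewrite -EFinM -EFinN -EFinD lee_fin.
  by rewrite mulrDl addrK ler_pM2l.
have Hprimal a b : attainable P L D c a b -> (a <= eps)%R ->
    (b - kappa * a)%:E <= primal.
  move=> [eta [nu [pi [cpl da bL]]]] aeps.
  have Da := le_trans (OTreg_div_le P D c eta nu pi cpl) da.
  have Deps : OTreg_div D c nu P <= eps%:E by rewrite (le_trans Da)// lee_fin.
  apply: (@le_trans _ _ (\int[nu]_x L x - kappa%:E * OTreg_div D c nu P)); last first.
    by apply: ereal_sup_ubound; exists nu.
  have := OTreg_div_ge0 P D c D0 c0 nu.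
  case: (OTreg_div D c nu P) Da => [r| |] //; rewrite !lee_fin => ra r0.
  rewrite -EFinM leeBrDr// (le_trans _ bL)// -EFinD lee_fin.
  have : (kappa * r <= kappa * a)%R by rewrite ler_wpM2l.
  by lra.
case primalE: primal => [v| |]; last 2 first.
- exact: leey.
(* The primal value is not [-oo]: the diagonal plan of [P] is feasible at cost 0 and its value is
   not [-oo]. *)
- have := integral_P_gtNy P L mL Lb.
  have diag b := attainable_diag P L D c pol DP mc cxx b.
  have noNy b : ~ b%:E <= \int[P]_x L x.
    by move=> /diag/Hprimal/(_ (ltW eps0)); rewrite primalE leeNy_eq.
  case: (\int[P]_x L x) diag noNy => [b| |] // _ noNy _; last first.
    by have := noNy 0%R; rewrite leey.
  by have := noNy b; rewrite lexx.
have [|lam lam0 Hlam] :=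
    strong_duality P L D c pol mL Loo D0 DP Dcvx mc c0 cxx Lb eps kappa v eps0 kappa0.
  by move=> a b Aab aeps; rewrite -lee_fin -primalE; exact: Hprimal.
apply/lee_addgt0Pr => e e0.
(* Adding [e / eps] makes the multiplier positive and raises [lam * eps] by exactly [e]. *)
have ee0 : (0 < e / eps)%R by rewrite divr_gt0.
have lam'0 : (0 < lam + e / eps)%R by rewrite ltr_wpDl.
apply: ge_ereal_inf; eexists; first by exists (lam + e / eps)%R.
have l0 : (0 < lam + e / eps + kappa)%R by rewrite ltr_wpDr.
apply: (le_trans (leeD2l _ (Hlam _ l0 _))); first by rewrite lerD2r lerDl ltW.
rewrite -EFinM -!EFinD lee_fin mulrDl divfK ?gt_eqF//; lra.
Qed.
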